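(* Let $A$ be a Noetherian ring with integral closure $A'$ (in its total quotient ring). Assume that $A_{(P\cap A)}$ is a DVR for every minimal regular prime ideal $P$ of $A'$. The following are equivalent. (a) $A$ is perinormal. (b) Whenever $P$ is a prime ideal of $A$ and $B$ is an overring of $A_{(P)}$ such that the extension $A_{(P)}\subseteq B$ is integral and unibranched, we have $A_{(P)}=B$.
   Context: All rings are commutative with unity. For a ring $A$, $\mathrm{Reg}(A)$ is the set of regular elements (non-zero-divisors) of $A$, and the total quotient ring $K$ of $A$ is the fraction ring of $A$ with denominators in $\mathrm{Reg}(A)$. An ideal of $A$ is regular if it contains a regular element. A prime ideal is minimal regular if it is minimal in the set of regular prime ideals. An overring of $A$ is a ring $B$ with $A\subseteq B\subseteq K$. A ring extension $A\subseteq B$ satisfies going down if, whenever $P_1\subseteq P_2$ are prime ideals of $A$ and $Q_2$ is a prime ideal of $B$ with $Q_2\cap A=P_2$, there is a prime ideal $Q_1\subseteq Q_2$ of $B$ with $Q_1\cap A=P_1$. A GD-overring of $A$ is an overring $B$ of $A$ such that $A\subseteq B$ satisfies going down. A ring $A$ is perinormal if every GD-overring of $A$ is flat as an $A$-module. A ring extension $A\subseteq B$ is unibranched if the contraction map $\mathrm{Spec}(B)\rightarrow\mathrm{Spec}(A)$ is bijective. For a prime ideal $P$ of $A$, the regular quotient ring $A_{(P)}$ is the fraction ring of $A$ with denominators in $(A-P)\cap \mathrm{Reg}(A)$; it is an overring of $A$. A valuation on a ring $K$ is a surjective map $v:K\rightarrow G\cup\{\infty\}$, with $(G,+)$ a totally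 ordered abelian group, such that $v(xy)=v(x)+v(y)$ and $v(x+y)\geq\min\{v(x),v(y)\}$ for all $x,y\in K$, $v(1)=0$ and $v(0)=\infty$. A ring $V$ with total quotient ring $K$ is a discrete valuation ring (DVR) if there is a valuation $v:K\to\mathbb{Z}\cup\{\infty\}$ on $K$ with value group $G=\mathbb{Z}$ such that $V=\{x\in K\mid v(x)\geq 0\}$. *)

(* Defs.v *)
From HB Require Import structures.
From mathcomp Require Import all_boot all_order all_algebra.
From mathcomp Require Import boolp.

Set Implicit Arguments.
Unset Strict Implicit.
Unset Printing Implicit Defensive.

Import Order.TTheory GRing.Theory Num.Theory.

Local Open Scope ring_scope.

(* The rings of interest all lie in one ambient ring K, the total quotient    *)
(* ring; they are subrings A : subringClosed K, and subring_of A is A as a    *)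
(* ring in its own right. Ring-theoretic notions are stated for ring types    *)
(* and ring morphisms. Ideals are the boolean predicates of ring_quotient;    *)
(* with the choice axiom of boolp every subset is one.                        *)

Section SubringType.

Variables (K : comNzRingType) (A : subringClosed K).

Record subring_of := SubringOf {
  subring_val : K;
  subring_valP : subring_val \in A
}.

HB.instance Definition _ := [isSub for subring_val].
HB.instance Definition _ := [Choice of subring_of by <:].
HB.instance Definition _ := [SubChoice_isSubComNzRing of subring_of by <:].

End SubringType.

Section Inclusion.

Variables (K : comNzRingType) (A B : subringClosed K).
Variable AB : {subset A <= B}.

Definition incl (x : subring_of A) : subring_of B :=
  SubringOf (AB (subring_valP x)).

Fact incl_is_additive : zmod_morphism incl.
Proof. by move=> x y; apply: val_inj. Qed.

Fact incl_is_multiplicative : monoid_morphism incl.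
Proof.
by split=> [|x y]; apply: val_inj.
Qed.

HB.instance Definition _ :=
  GRing.isZmodMorphism.Build (subring_of A) (subring_of B) incl
    incl_is_additive.
HB.instance Definition _ :=
  GRing.isMonoidMorphism.Build (subring_of A) (subring_of B) incl
    incl_is_multiplicative.

End Inclusion.

Definition noetherian (R : comNzRingType) : Prop :=
  forall I : {pred R^o}, submod_closed I ->
  exists n (g : 'I_n -> R), forall x : R,
    x \in I <-> exists c : 'I_n -> R, x = \sum_(i < n) c i * g i.

(* Spec R is the type prime_idealr R (proper prime ideals).                   *)

Lemma prime_idealr_ext (R : comNzRingType) (P Q : prime_idealr R) :
  P =i Q -> P = Q.
Proof.
case: P Q => [p cp] [q cq] /= pq.
have e : p = q by apply: funext => x; exact: pq.
case: q / e cq {pq} => cq; congr (PrimeIdealr.Pack _).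
case: cp cq => [[a1] [a2] [b] [d]] [[a1'] [a2'] [b'] [d']].
by rewrite (Prop_irrelevance a1 a1') (Prop_irrelevance a2 a2')
  (Prop_irrelevance b b') (Prop_irrelevance d d').
Qed.

Section Contraction.

Variables (R S : comNzRingType) (f : {rmorphism R -> S}).

Definition contraction (Q : prime_idealr S) : {pred R} := [pred x | f x \in Q].

Fact contraction_idealr Q : idealr_closed (contraction Q).
Proof.
split=> [||a u v]; rewrite !inE; first by rewrite rmorph0 rpred0.
  by rewrite rmorph1 idealr1.
by move=> Qu Qv; rewrite rmorphD rmorphM rpredD ?idealMr.
Qed.

Fact contraction_prime Q : prime_idealr_closed (contraction Q).
Proof. by move=> u v; rewrite !inE rmorphM prime_idealrM. Qed.

HB.instance Definition _ Q :=
  isIdealr.Build R (contraction Q) (contraction_idealr Q).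
HB.instance Definition _ Q :=
  isPrimeIdealrClosed.Build R (contraction Q) (@contraction_prime Q).

Definition spec_map (Q : prime_idealr S) : prime_idealr R := contraction Q.

Definition going_down : Prop :=
  forall (P1 P2 : prime_idealr R) (Q2 : prime_idealr S),
    {subset P1 <= P2} -> spec_map Q2 = P2 ->
  exists2 Q1 : prime_idealr S, {subset Q1 <= Q2} & spec_map Q1 = P1.

Definition unibranched : Prop := bijective spec_map.

Definition integral_ext : Prop := integralRange f.

End Contraction.

Definition regular_ideal (R : comNzRingType) (I : {pred R}) : Prop :=
  exists2 x, x \in I & GRing.lreg x.

Definition minimal_regular_prime (R : comNzRingType) (P : prime_idealr R) :=
  regular_ideal P /\
  forall Q : prime_idealr R, regular_ideal Q -> {subset Q <= P} -> Q = P.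

(* The formal sums m_1 (x) n_1 + ... + m_k (x) n_k, as lists of pairs, modulo *)
(* tensor_eq are the elements of the tensor product of M and N over R; by     *)
(* tensor0 and tensorDl, (- m) (x) n is the opposite of m (x) n.              *)
Inductive tensor_eq (R : comNzRingType) (M N : lmodType R) :
    seq (M * N) -> seq (M * N) -> Prop :=
| tensor_refl s : tensor_eq s s
| tensor_sym s t : tensor_eq s t -> tensor_eq t s
| tensor_trans s t u : tensor_eq s t -> tensor_eq t u -> tensor_eq s u
| tensor_cat s s' t t' :
    tensor_eq s s' -> tensor_eq t t' -> tensor_eq (s ++ t) (s' ++ t')
| tensorC s t : tensor_eq (s ++ t) (t ++ s)
| tensor0 n : tensor_eq [:: (0, n)] [::]
| tensorDl m m' n : tensor_eq [:: (m + m', n)] [:: (m, n); (m', n)]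
| tensorDr m n n' : tensor_eq [:: (m, n + n')] [:: (m, n); (m, n')]
| tensorZ a m n : tensor_eq [:: (a *: m, n)] [:: (m, a *: n)].

Definition tensor_map (R : comNzRingType) (M N N' : lmodType R)
    (g : {linear N -> N'}) (s : seq (M * N)) : seq (M * N') :=
  [seq (p.1, g p.2) | p <- s].

Definition flat (R : comNzRingType) (M : lmodType R) : Prop :=
  forall (N N' : lmodType R) (g : {linear N -> N'}), injective g ->
  forall s t : seq (M * N),
    tensor_eq (tensor_map g s) (tensor_map g t) -> tensor_eq s t.

(* S as an R-module along f : R -> S.                                         *)
Definition restr_scalars (R S : comNzRingType) (f : {rmorphism R -> S}) : Type
  := S.

Section RestrScalars.

Variables (R S : comNzRingType) (f : {rmorphism R -> S}).

HB.instance Definition _ := GRing.Zmodule.on (restr_scalars f).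

Definition restr_scale (a : R) (x : restr_scalars f) : restr_scalars f :=
  f a * (x : S).

Fact restr_scaleA a b x :
  restr_scale a (restr_scale b x) = restr_scale (a * b) x.
Proof. by rewrite /restr_scale rmorphM mulrA. Qed.

Fact restr_scale1 : left_id 1 restr_scale.
Proof. by move=> x; rewrite /restr_scale rmorph1 mul1r. Qed.

Fact restr_scaleDr : right_distributive restr_scale +%R.
Proof. by move=> a x y; rewrite /restr_scale mulrDr. Qed.

Fact restr_scaleDl x : {morph restr_scale^~ x : a b / a + b}.
Proof. by move=> a b; rewrite /restr_scale rmorphD mulrDl. Qed.

HB.instance Definition _ := GRing.Zmodule_isLmodule.Build R (restr_scalars f)
  restr_scaleA restr_scale1 restr_scaleDr restr_scaleDl.

End RestrScalars.

Definition is_total_quotient_ring (K : comUnitRingType) (A : subringClosed K) :=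
  (forall s : subring_of A, GRing.lreg s -> val s \is a GRing.unit) /\
  (forall x : K, exists a s : subring_of A,
     GRing.lreg s /\ x = val a / val s).

(* For A with total quotient ring K, the B : subringClosed K containing A are *)
(* the overrings of A.                                                        *)
Definition perinormal (K : comUnitRingType) (A : subringClosed K) : Prop :=
  forall (B : subringClosed K) (AB : {subset A <= B}),
    going_down (incl AB) -> flat (restr_scalars (incl AB)).

Section IntegralClosure.

Variables (K : comUnitRingType) (A : subringClosed K).

Definition integral_closure : {pred K} :=
  [pred x | `[< integralOver (val : subring_of A -> K) x >]].

Fact integral_closure_subring : subring_closed integral_closure.
Proof.
split=> [|x y|x y]; rewrite !inE.
- by apply/asboolP; exact: integral1.
- by move=> /asboolP Ax /asboolP Ay; apply/asboolP; exact: integral_sub.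
- by move=> /asboolP Ax /asboolP Ay; apply/asboolP; exact: integral_mul.
Qed.

HB.instance Definition _ :=
  GRing.isSubringClosed.Build K integral_closure integral_closure_subring.

Lemma sub_integral_closure : {subset A <= integral_closure}.
Proof.
move=> x Ax; rewrite inE; apply/asboolP.
exact: (integral_id _ (SubringOf Ax)).
Qed.

End IntegralClosure.

Section RegularQuotientRing.

Variables (K : comUnitRingType) (A : subringClosed K).
Variable P : prime_idealr (subring_of A).

(* A_(P): when K is the total quotient ring of A, val s is a unit of K and    *)
(* the equation says x = a / s.                                               *)
Definition regular_quotient : {pred K} :=
  [pred x | `[< exists a s : subring_of A,
                [/\ s \notin P, GRing.lreg s & x * val s = val a] >]].

Fact regular_quotient_subring : subring_closed regular_quotient.
Proof.
have PM s t : s \notin P -> t \notin P -> s * t \notin P.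
  by rewrite prime_idealrM negb_or => -> ->.
split=> [|x y|x y]; rewrite !inE.
- apply/asboolP; exists 1, 1; rewrite idealr1; split=> //; first exact: lreg1.
  by rewrite mul1r.
- move=> /asboolP[a [s [Ps rs xs]]] /asboolP[b [t [Pt rt yt]]].
  apply/asboolP; exists (a * t - b * s), (s * t).
  split; [exact: PM | exact: lregM |].
  by rewrite rmorphB !rmorphM /= -xs -yt mulrBl mulrA; congr (_ - _);
    rewrite [RHS]mulrAC mulrA mulrAC.
- move=> /asboolP[a [s [Ps rs xs]]] /asboolP[b [t [Pt rt yt]]].
  apply/asboolP; exists (a * b), (s * t).
  split; [exact: PM | exact: lregM |].
  by rewrite !rmorphM /= -xs -yt mulrACA.
Qed.

HB.instance Definition _ :=
  GRing.isSubringClosed.Build K regular_quotient regular_quotient_subring.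

End RegularQuotientRing.

(* Z with a largest element adjoined, which is None.                          *)
Notation intoo := (option int).

Definition oo_add (m n : intoo) : intoo :=
  if (m, n) is (Some i, Some j) then Some (i + j) else None.

Definition oo_le (m n : intoo) : bool :=
  match m, n with
  | _, None => true
  | None, Some _ => false
  | Some i, Some j => i <= j
  end.

Definition oo_min (m n : intoo) : intoo := if oo_le m n then m else n.

Record is_discrete_valuation (K : comNzRingType) (v : K -> intoo) : Prop := {
  valuation_surj : forall m, exists x, v x = m;
  valuationM : forall x y, v (x * y) = oo_add (v x) (v y);
  valuationD : forall x y, oo_le (oo_min (v x) (v y)) (v (x + y));
  valuation1 : v 1 = Some 0;
  valuation0 : v 0 = None
}.

Definition is_DVR (K : comUnitRingType) (V : subringClosed K) : Prop :=
  is_total_quotient_ring V /\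
  exists2 v : K -> intoo, is_discrete_valuation v &
    forall x, x \in V <-> oo_le (Some 0) (v x).

(* Main.v *)
(* Both implications rest on the following description of flatness: an        *)
(* overring B of A is flat if and only if no prime ideal of B contains an     *)
(* ideal (A : b) with b in B.                                                 *)
(*                                                                            *)
(* An integral unibranched overring B of A_(P) satisfies going down over A,   *)
(* so it is flat if A is perinormal; if b in B is not in A_(P), lying over    *)
(* gives a prime ideal of B above (A : b), a contradiction.                   *)
(*                                                                            *)
(* Conversely let B be a GD-overring, let Q be a prime ideal of B and         *)
(* q = Q `&` A. For a minimal regular prime p' of A' with p = p' `&` A in q,  *)
(* going down gives a prime Q1 in Q above p, and B_(Q1) = A_(p) as A_(p) is a *)
(* DVR. So B_(Q) lies in all these A_(p), and by a Mori-Nagata type theorem   *)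
(* it is integral over A_(q). Hence the localization of B at q is integral    *)
(* and unibranched over A_(q), so by (b) it is equal to A_(q), B is contained *)
(* in A_(q), and (A : b) is not contained in Q.                               *)
(*                                                                            *)
(* The Mori-Nagata step asks, for z in K not integral over A_(q), for a       *)
(* minimal regular prime p' of A' with z not in A_(p). A maximal conductor    *)
(* yields a prime P and a multiple y of z with P y integral over R = A_(P),   *)
(* y not. Let R1 be a finite extension of R containing P y, and T the ring of *)
(* all x integral over R with P^k x in R1 for some k. By Matijevic's argument *)
(* the relevant ideals of T are finitely generated. If I is the radical of    *)
(* P T and y1 in T y is not in T but I y1 is in T, then I y1 is not in I      *)
(* since y1 is not integral; for i in I with i y1 not in I, the ideal I is    *)
(* generated by i near a prime n of T that does not contain i y1, whence n is *)
(* minimal regular, and a prime of A' above it is the p' sought.              *)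

Require Import Defs.
From HB Require Import structures.
From mathcomp Require Import all_boot all_order all_algebra.
From mathcomp Require Import zify ring boolp classical_sets.

Set Implicit Arguments.
Unset Strict Implicit.
Unset Printing Implicit Defensive.

Import GRing.Theory.

Local Open Scope classical_set_scope.
Local Open Scope ring_scope.

(** * Submodules of K *)

(** Flatness of an overring is a question of denominators. If for every [b] in [B] and every prime
    [Q] of [B] some [i] in [A] outside [Q] has [i * b] in [A], then equality of tensors can be
    tested prime by prime and [B] is flat ([flat_overring]). If this fails for some [b] and [Q], the
    inclusion of [A + b A] in [K] witnesses that [B] is not flat ([flat_not_prime]).

    From (a) to (b): going up along an integral extension, combined with uniqueness of the primes
    above, gives going down ([going_down_unibranched]); flatness then leaves no room for a proper
    conductor ([flat_integral_eq]).

    From (b) to (a): a GD-overring is locally integral over [A]. An element [z] that is not integral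
    over A_(q) is missing from A_(p) for some [p] in [q] that is the contraction of a minimal
    regular prime of A' ([nonintegral_minimal_regular]). As A_(p) is a DVR, [z] has a pole at [p],
    which the prime given by going down over [p] does not allow ([going_down_integral]). The same
    integrality makes primes with equal contraction coincide ([same_contraction_sub]), so (b)
    applies to the localization of [B] at [q] ([sub_regular_quotient_going_down]).

    As [K] may have zero divisors, A_(P) need not be local and only units of [K] can be inverted.
    The remedy throughout is [regular_translate]: a coset a + s A with [s] regular contains a
    regular element. The existence of [p] rests on [minimal_prime_transform], where finite
    generation from [transform_ideal_fg] stands in for a Noetherian integral closure. *)

Section Submodules.

Variable K : comUnitRingType.
Implicit Types (A B : subringClosed K) (I J M N : set K) (l : seq K).

Definition submodule A M :=
  [/\ M 0, forall x y, M x -> M y -> M (x + y)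
    & forall a x, a \in A -> M x -> M (a * x)].

(** Coefficients are peeled off one at a time, so that inductions on [l] need no indexed sums;
    [spanP] recovers the sums. *)
Fixpoint span A l (x : K) : Prop :=
  if l is g :: l' then exists2 c, c \in A & span A l' (x - c * g) else x = 0.

Definition noeth A :=
  forall I, submodule A I -> (forall x, I x -> x \in A) ->
  exists l, I = span A l.

Section FixedRing.

Variables (A : subringClosed K) (M : set K) (modM : submodule A M).

Lemma submod0 : M 0. Proof. by case: modM. Qed.

Lemma submodD x y : M x -> M y -> M (x + y).
Proof. by case: modM => _ + _; apply. Qed.

Lemma submodZ a x : a \in A -> M x -> M (a * x).
Proof. by case: modM => _ _; apply. Qed.

Lemma submodZr a x : a \in A -> M x -> M (x * a).
Proof. by rewrite mulrC; apply: submodZ. Qed.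

Lemma submodN x : M x -> M (- x).
Proof. by rewrite -mulN1r; apply: submodZ; rewrite rpredN1. Qed.

Lemma submodB x y : M x -> M y -> M (x - y).
Proof. by move=> Mx My; apply/submodD/submodN. Qed.

Lemma submod_sum (T : Type) (r : seq T) (P : pred T) (F : T -> K) :
  (forall i, P i -> M (F i)) -> M (\sum_(i <- r | P i) F i).
Proof. exact: (big_ind M submod0 submodD). Qed.

Lemma submod_subD x y : M y -> M (x + y) -> M x.
Proof. by move=> My /submodB /(_ My); rewrite addrK. Qed.

Lemma submod_subB x y : M y -> M (x - y) -> M x.
Proof. by move=> My /submodD /(_ My); rewrite subrK. Qed.

End FixedRing.

Lemma submodS A B M : {subset A <= B} -> submodule B M -> submodule A M.
Proof.
move=> AB modM; split=> [|x y|a x /AB]; first exact: submod0 modM.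
  exact: (submodD modM).
exact: (submodZ modM).
Qed.

Lemma submodule_subring A : submodule A [set` A].
Proof.
split=> [|x y|a x] /=; [exact: rpred0 | exact: rpredD | exact: rpredM].
Qed.

Lemma submodule_setI A M N :
  submodule A M -> submodule A N -> submodule A (M `&` N).
Proof.
move=> modM modN; split=> [|x y [Mx Nx] [My Ny]|a x Aa [Mx Nx]].
- by split; [exact: submod0 modM | exact: submod0 modN].
- by split; [exact: (submodD modM Mx My) | exact: (submodD modN Nx Ny)].
- by split; [exact: (submodZ modM Aa Mx) | exact: (submodZ modN Aa Nx)].
Qed.

Lemma submodule_preimM A M c :
  submodule A M -> submodule A [set x | M (c * x)].
Proof.
move=> modM; split=> [|x y|a x Aa] /=.
- by rewrite mulr0; exact: submod0 modM.
- by rewrite mulrDr; exact: (submodD modM).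
- by rewrite mulrCA; exact: (submodZ modM Aa).
Qed.

Definition addm M N : set K := [set x | exists2 y, M y & N (x - y)].

Lemma addmI M N y z : M y -> N z -> addm M N (y + z).
Proof. by move=> My Nz; exists y => //; rewrite addrC addKr. Qed.

Lemma submodule_addm A M N :
  submodule A M -> submodule A N -> submodule A (addm M N).
Proof.
move=> modM modN; split=> [|x y [x' Mx Nx] [y' My Ny]|a x Aa [x' Mx Nx]].
- by exists 0; rewrite ?subr0; [exact: submod0 modM | exact: submod0 modN].
- exists (x' + y'); first exact: (submodD modM Mx My).
  by rewrite opprD addrACA; exact: (submodD modN Nx Ny).
- exists (a * x'); first exact: (submodZ modM Aa Mx).
  by rewrite -mulrBr; exact: (submodZ modN Aa Nx).
Qed.

Lemma addm_subl A M N x : submodule A N -> M x -> addm M N x.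
Proof. by move=> modN Mx; exists x; rewrite // subrr; exact: submod0 modN. Qed.

Lemma addm_subr A M N x : submodule A M -> N x -> addm M N x.
Proof. by move=> modM Nx; exists 0; rewrite ?subr0 //; exact: submod0 modM. Qed.

Lemma submodule_span A l : submodule A (span A l).
Proof.
elim: l => [|g l IHl] /=.
  by split=> [//|x y -> ->|a x _ ->]; rewrite ?addr0 ?mulr0.
split=> [|x y [c Ac lx] [d Ad ly]|a x Aa [c Ac lx]] /=.
- by exists 0; rewrite ?rpred0 // mul0r subr0; exact: submod0 IHl.
- exists (c + d); rewrite ?rpredD // mulrDl opprD addrACA.
  exact: (submodD IHl lx ly).
- exists (a * c); rewrite ?rpredM // -mulrA -mulrBr.
  exact: (submodZ IHl Aa lx).
Qed.

Lemma mem_span A l g : g \in l -> span A l g.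
Proof.
elim: l => [//|h l IHl]; rewrite inE => /predU1P[->|/IHl lg] /=.
  by exists 1; rewrite ?rpred1 // mul1r subrr;
    exact: submod0 (submodule_span _ _).
by exists 0; rewrite ?rpred0 // mul0r subr0.
Qed.

Lemma span_min A l M x :
  submodule A M -> (forall g, g \in l -> M g) -> span A l x -> M x.
Proof.
move=> modM; elim: l x => [|g l IHl] x lM /=.
  by move->; exact: submod0 modM.
case=> c Ac /IHl lx; rewrite -[x](subrK (c * g)).
apply: (submodD modM (lx _) _) => [h lh|].
  by apply: lM; rewrite inE lh orbT.
by apply: (submodZ modM Ac (lM _ _)); rewrite mem_head.
Qed.

Lemma span_subset A B l l' x : {subset A <= B} -> {subset l <= l'} ->
  span A l x -> span B l' x.
Proof.
move=> AB ll'; apply: span_min => [|g /ll'].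
  exact: submodS AB (submodule_span _ _).
exact: mem_span.
Qed.

Lemma span_cat A l l' x :
  span A (l ++ l') x <-> addm (span A l) (span A l') x.
Proof.
split=> [|[y ly lxy]].
  apply: span_min => [|g]; first
    exact/submodule_addm/submodule_span/submodule_span.
  rewrite mem_cat => /orP[]/(mem_span A).
    exact: addm_subl (submodule_span _ _).
  exact: addm_subr (submodule_span _ _).
rewrite -[x](subrK y); apply: (submodD (submodule_span _ _) _ _).
  by move: lxy; apply: span_subset => // g; rewrite mem_cat => ->; rewrite orbT.
by move: ly; apply: span_subset => // g; rewrite mem_cat => ->.
Qed.

(** The coefficients at [g] of the elements of [N] form an ideal [I]. Lifts to [N] of generators of
    [I], together with generators of the part of [N] inside [span A l], generate [N]. *)
Lemma fg_submodule A l N : noeth A -> submodule A N ->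
  (forall x, N x -> span A l x) -> exists l', N = span A l'.
Proof.
move=> noeA; elim: l N => [|g l IHl] N modN Nl.
  exists [::]; apply/seteqP; split=> x /= => [/Nl //|->]; exact: submod0 modN.
pose I := [set c | c \in A /\ exists2 x, N x & span A l (x - c * g)].
have modI : submodule A I.
  split=> [|c d [Ac [x Nx lx]] [Ad [y Ny ly]]|a c Aa [Ac [x Nx lx]]].
  - split; first exact: rpred0.
    exists 0; first exact: submod0 modN.
    by rewrite mul0r subr0; exact: submod0 (submodule_span _ _).
  - split; first exact: rpredD.
    exists (x + y); first exact: (submodD modN Nx Ny).
    rewrite mulrDl opprD addrACA; exact: (submodD (submodule_span _ _) lx ly).
  - split; first exact: rpredM.
    exists (a * x); first exact: (submodZ modN Aa Nx).
    rewrite -mulrA -mulrBr; exact: (submodZ (submodule_span _ _) Aa lx).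
have [|cs Ics] := noeA I modI; first by move=> x [].
have [l' Nl'] : exists l', (N `&` span A l) = span A l'.
  apply: IHl => [|x []//]; exact: submodule_setI modN (submodule_span _ _).
have /choice[f fP] c : exists x, I c -> N x /\ span A l (x - c * g).
  by have [[_ [x]]|] := pselect (I c); [exists x | exists 0].
exists (map f cs ++ l'); apply/seteqP; split=> x.
  move=> Nx; have [c Ac lx] := Nl _ Nx.
  have Ic : I c by split=> //; exists x.
  have [y [ly Ny lcy]] :
      exists y, [/\ span A (map f cs) y, N y & span A l (y - c * g)].
    have : span A cs c by rewrite -Ics.
    apply: (@span_min A cs [set c | exists y,
        [/\ span A (map f cs) y, N y & span A l (y - c * g)]]) => [|d dcs].
      split=> [|d d' [y [ly Ny lcy]]
        [y' [ly' Ny' lcy']]|a d Aa [y [ly Ny lcy]]].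
      - exists 0; rewrite mul0r subrr.
        by split; [exact: submod0 (submodule_span _ _) | exact: submod0 modN
          | exact: submod0 (submodule_span _ _)].
      - exists (y + y'); rewrite mulrDl opprD addrACA.
        by split; [exact: (submodD (submodule_span _ _) ly ly')
          | exact: (submodD modN Ny Ny')
          | exact: (submodD (submodule_span _ _) lcy lcy')].
      - exists (a * y); rewrite -mulrA -mulrBr.
        by split; [exact: (submodZ (submodule_span _ _) Aa ly)
          | exact: (submodZ modN Aa Ny)
          | exact: (submodZ (submodule_span _ _) Aa lcy)].
    have Id : I d by rewrite Ics; exact: mem_span.
    have [Nd ld] := fP _ Id.
    exists (f d); split=> //; exact/mem_span/map_f.
  apply/span_cat; exists y => //; rewrite -Nl'; split.
    exact: (submodB modN Nx Ny).
  have -> : x - y = (x - c * g) - (y - c * g) by ring.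
  exact: (submodB (submodule_span _ _) lx lcy).
apply: (span_min modN) => h; rewrite mem_cat => /orP[/mapP[c ccs ->]|hl'].
  by have [] := fP c; first by rewrite Ics; exact: mem_span.
by have : (N `&` span A l) h; [rewrite Nl'; exact: mem_span|case].
Qed.

Lemma noeth_maximal A (F : set (set K)) I : noeth A ->
  (forall J, F J -> submodule A J /\ (forall x, J x -> x \in A)) -> F I ->
  exists2 J, F J & forall J', F J' -> (J `<=` J') -> J' = J.
Proof.
move=> noeA Fmod FI; apply: contrapT => noM.
have next (J : {J | F J}) : {J' : {J | F J} | (sval J `<` sval J')}.
  case: J => J FJ /=; apply/cid; apply: contrapT => noJ; apply: noM.
  exists J => // J' FJ' JJ'; apply: contrapT => neqJ; apply: noJ.
  exists (exist _ J' FJ') => /=; split=> // J'J.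
  by apply: neqJ; apply/seteqP; split.
pose s n := iter n (fun J : {J | F J} => sval (next J)) (exist _ I FI).
have sS n : (sval (s n) `<` sval (s n.+1)) by exact: svalP (next (s n)).
have s_le m n : (m <= n)%N -> (sval (s m) `<=` sval (s n)).
  elim: n => [|n IHn]; first by rewrite leqn0 => /eqP->.
  rewrite leq_eqVlt => /predU1P[->//|/IHn sm]; apply: subset_trans sm _.
  by case: (sS n).
pose U := [set x | exists n, sval (s n) x].
have mods n := (Fmod _ (svalP (s n))).1.
have modU : submodule A U.
  split=> [|x y [m smx] [n sny]|a x Aa [n snx]].
  - by exists 0%N; exact: submod0 (mods _).
  - exists (maxn m n); apply: (submodD (mods _) _ _).
      exact: s_le (leq_maxl _ _) _ smx.
    exact: s_le (leq_maxr _ _) _ sny.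
  - by exists n; exact: (submodZ (mods _) Aa snx).
have [|l Ul] := noeA U modU.
  by move=> x [n snx]; exact: (Fmod _ (svalP (s n))).2 _ snx.
have [n ln] : exists n, forall g, g \in l -> sval (s n) g.
  have: forall g, g \in l -> U g by move=> g /(mem_span A); rewrite Ul.
  elim: (l) => [|g l' IHl lU]; first by exists 0%N.
  have [|n ln] := IHl; first by move=> h lh; apply: lU; rewrite inE lh orbT.
  have [m smg] := lU g (mem_head _ _).
  exists (maxn m n) => h; rewrite inE => /predU1P[->|/ln snh].
    exact: s_le (leq_maxl _ _) _ smg.
  exact: s_le (leq_maxr _ _) _ snh.
have [_] := sS n; apply=> x snx.
have : U x by exists n.+1.
by rewrite Ul; exact: (span_min (mods n) ln).
Qed.

End Submodules.

(** * Prime ideals and integral extensions *)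

Section Primes.

Variable K : comUnitRingType.
Implicit Types (A B : subringClosed K) (I J M N P Q : set K).

Definition ideal_of A I := submodule A I /\ forall x, I x -> x \in A.

Definition prime_of A P :=
  [/\ submodule A P, forall x, P x -> x \in A, ~ P 1
    & forall x y, x \in A -> y \in A -> P (x * y) -> P x \/ P y].

Lemma prime_mod A P : prime_of A P -> submodule A P. Proof. by case. Qed.

Lemma prime_sub A P x : prime_of A P -> P x -> x \in A.
Proof. by case=> _ + _ _; apply. Qed.

Lemma prime_proper A P : prime_of A P -> ~ P 1. Proof. by case. Qed.

Lemma primeM A P x y :
  prime_of A P -> x \in A -> y \in A -> P (x * y) -> P x \/ P y.
Proof. by case=> _ _ _; apply. Qed.

Lemma primeMn A P x y : prime_of A P -> x \in A -> y \in A ->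
  ~ P x -> ~ P y -> ~ P (x * y).
Proof. by move=> pP Ax Ay Px Py /(primeM pP Ax Ay)[]. Qed.

Lemma primeX A P x n : prime_of A P -> x \in A -> P (x ^+ n) -> P x.
Proof.
move=> pP Ax; elim: n => [|n IHn]; first by move/(prime_proper pP).
by rewrite exprS => /(primeM pP Ax (rpredX _ Ax))[].
Qed.

Lemma ideal_prime A P : prime_of A P -> ideal_of A P. Proof. by case. Qed.

(** An ideal maximal among those that contain [J] and miss [S] is prime, because adjoining any
    further element makes it meet [S]. The last clause keeps the maximality, which [lying_over]
    exploits. *)
Lemma prime_disjoint A J (S : set K) : ideal_of A J ->
  S 1 -> (forall x y, S x -> S y -> S (x * y)) -> J `&` S `<=` set0 ->
  exists P, [/\ prime_of A P, J `<=` P, P `&` S `<=` set0 &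
    forall I, ideal_of A I -> P `<=` I -> I `&` S `<=` set0 -> I `<=` P].
Proof.
move=> [modJ JA] S1 SM JS.
(* Zorn's lemma also asks about the empty chain, whose union is empty; hence the condition bears on
   the union of [J] and [X]. *)
pose good X := ideal_of A (J `|` X) /\ (J `|` X) `&` S `<=` set0.
have [|X [[[modX XA] XS] Xmax]] := @Zorn_bigcup K good.
  move=> F Fgood Ftot; have [[X0 FX0]|F0] := pselect (exists X, F X);
    last first.
    suff -> : \bigcup_(X in F) X = set0 by rewrite /good setU0.
    by apply/seteqP; split=> // x [X FX]; case: F0; exists X.
  have in_one x : (J `|` \bigcup_(X in F) X) x -> exists2 X, F X & (J `|` X) x.
    by case=> [Jx|[X FX Xx]]; [exists X0; rewrite //; left | exists X;
      rewrite //; right].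
  have out X x : F X -> (J `|` X) x -> (J `|` \bigcup_(X in F) X) x.
    by move=> FX [Jx|Xx]; [left | right; exists X].
  split; last first.
    by move=> x [/in_one[X /Fgood[_ XS] Xx] Sx]; apply: (XS x).
  split; last by move=> x /in_one[X /Fgood[[_ XA] _]]; apply: XA.
  split=> [|x y|a x Aa].
  - by left; exact: submod0 modJ.
  - move=> /in_one[X FX Xx] /in_one[Y FY Yy].
    have [XY|YX] := Ftot _ _ FX FY.
      apply: (out Y) => //; have [[modY _] _] := Fgood _ FY.
      by apply: (submodD modY) => //; case: Xx => [|/XY]; [left | right].
    apply: (out X) => //; have [[modX _] _] := Fgood _ FX.
    by apply: (submodD modX) => //; case: Yy => [|/YX]; [left | right].
  - move=> /in_one[X FX Xx]; apply: (out X) => //.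
    by have [[modX _] _] := Fgood _ FX; apply: (submodZ modX).
set P := J `|` X in modX XA XS.
have Pmax I : ideal_of A I -> P `<=` I -> I `&` S `<=` set0 -> I `<=` P.
  move=> idI PI IS; apply: contrapT => IP.
  have JI : J `|` I = I by apply/seteqP; split=> x; [case=> // Jx; apply: PI;
    left | right].
  apply: (Xmax I); last by rewrite /good JI.
  split=> [|IX]; first by move=> x Xx; apply: PI; right.
  by apply: IP => x /IX; right.
have meetS x : x \in A -> ~ P x ->
    exists s, [/\ S s, s \in A & exists2 a, a \in A & P (s - a * x)].
  move=> Ax Px; apply: contrapT => noS; apply: Px.
  apply: (Pmax (addm P (span A [:: x]))); first split.
  - exact: submodule_addm modX (submodule_span _ _).
  - move=> y [z /XA Az [a Aa /eqP]]; rewrite subr_eq0 => /eqP yz.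
    by rewrite -[y](subrK z) yz rpredD // rpredM.
  - move=> y; exact: addm_subl (submodule_span _ _).
  - move=> s [[z Pz [a Aa /eqP]]]; rewrite subr_eq0 => /eqP sz Ss.
    apply: noS; exists s; split=> //.
      by rewrite -[s](subrK z) sz rpredD ?rpredM // XA.
    by exists a; rewrite // -sz opprB addrC subrK.
  - by apply: addm_subr modX _; apply: mem_span; rewrite mem_head.
exists P; split=> //; last by left.
split=> // [P1|x y Ax Ay Pxy]; first exact: (XS 1).
apply: contrapT => /not_orP[/(meetS x Ax)[s [Ss As [a Aa sa]]]].
move=> /(meetS y Ay)[t [St At [b Ab tb]]].
apply: (XS (s * t)); split; last exact: SM.
have -> : s * t = t * (s - a * x) + (a * x) * (t - b * y) + (a * b) * (x * y).
  by ring.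
apply: (submodD modX); first apply: (submodD modX).
- exact: (submodZ modX).
- by apply: (submodZ modX) => //; rewrite rpredM.
- by apply: (submodZ modX) => //; rewrite rpredM.
Qed.

Lemma maximal_ideal A J : ideal_of A J -> ~ J 1 ->
  exists2 P, prime_of A P & J `<=` P.
Proof.
move=> idJ J1; have [//| |||P [pP JP _ _]] := @prime_disjoint A J [set 1].
- by [].
- by move=> x y -> ->; rewrite mulr1.
- by move=> x [Jx x1]; rewrite x1 in Jx.
- by exists P.
Qed.

Lemma submodXB A M x y n : submodule A M -> x \in A -> y \in A ->
  M (x - y) -> M (x ^+ n - y ^+ n).
Proof.
move=> modM Ax Ay Mxy; rewrite subrXX; apply: (submodZr modM) => //.
by apply: rpred_sum => i _; rewrite rpredM ?rpredX.
Qed.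

Lemma integral_closureP A x :
  x \in integral_closure A <->
  exists n (c : nat -> K),
    (forall i, c i \in A) /\ x ^+ n = \sum_(i < n) c i * x ^+ i.
Proof.
rewrite inE; split=> [[p mon_p /rootP px0] | [n [c [Ac xn]]]].
  exists (size p).-1, (fun i => - val p`_i).
  split=> [i|]; first by rewrite rpredN; exact: subring_valP.
  have szp : (size p).-1.+1 = size p.
    by rewrite prednK // lt0n size_poly_eq0 monic_neq0.
  have e : (map_poly val p).[x] = \sum_(i < (size p).-1.+1) val p`_i * x ^+ i.
    rewrite horner_coef szp size_map_inj_poly ?rmorph0 //; last exact: val_inj.
    by apply: eq_bigr => i _; rewrite coef_map_id0.
  move: px0; rewrite e big_ord_recr /=.
  have -> : p`_(size p).-1 = 1 by exact/eqP.
  rewrite mul1r addrC => /eqP; rewrite addr_eq0 => /eqP->.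
  by rewrite -sumrN; apply: eq_bigr => i _; rewrite mulNr.
pose d i := SubringOf (Ac i).
pose q := 'X^n - \poly_(i < n) d i; exists q.
  rewrite monicE lead_coefDl ?lead_coefXn // size_opp size_polyXn ltnS.
  exact: size_poly.
have -> : map_poly val q = 'X^n - map_poly val (\poly_(i < n) d i).
  by rewrite rmorphB; congr (_ - _); exact: map_polyXn.
apply/rootP; rewrite hornerD hornerN hornerXn.
rewrite (@horner_coef_wide _ n) ?size_map_inj_poly ?size_poly //;
  last exact: val_inj.
by rewrite xn -sumrB big1 // => i _;
  rewrite coef_map_id0 // coef_poly ltn_ord subrr.
Qed.

Lemma integral_closureS A B :
  {subset A <= B} -> {subset integral_closure A <= integral_closure B}.
Proof.
move=> AB x /integral_closureP[n [c [Ac xn]]]; apply/integral_closureP.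
by exists n, c; split=> // i; apply: AB.
Qed.

Lemma integral_closure_trans A B : {subset B <= integral_closure A} ->
  {subset integral_closure B <= integral_closure A}.
Proof.
move=> BA x; rewrite !inE => -[p mon_p px0].
apply: (@integral_root_monic _ _ val _ (map_poly val p)) => //.
  exact: monic_map.
apply/integral_poly => i; rewrite coef_map /=.
by have := BA _ (subring_valP p`_i); rewrite inE.
Qed.

Section IntegralExtension.

Variables A B : subringClosed K.
Hypotheses (AB : {subset A <= B}) (BA : {subset B <= integral_closure A}).

(* A maximal ideal Q of B with Q `&` A in P lies over P: if a is in P but not *)
(* in Q, some s = q + b * a is in A but not in P, and an equation of integral *)
(* dependence of b, scaled by a power of a, shows that a power of s is in P.  *)
Lemma lying_over H P : prime_of A P -> ideal_of B H ->
    (forall x, x \in A -> H x -> P x) ->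
  exists Q, [/\ prime_of B Q, H `<=` Q & forall x, x \in A -> Q x <-> P x].
Proof.
move=> pP idH HP.
have [||||Q [pQ HQ QS Qmax]] := @prime_disjoint B H [set x | x \in A /\ ~ P x].
- by [].
- by split; [exact: rpred1 | exact: prime_proper pP].
- move=> x y [Ax Px] [Ay Py]; split; first exact: rpredM.
  exact: (primeMn pP).
- by move=> x [Hx [Ax]]; apply; apply: HP.
have modQ := prime_mod pQ.
have QP x : x \in A -> Q x -> P x.
  by move=> Ax Qx; apply: contrapT => Px; apply: (QS x).
exists Q; split=> // a Aa; split=> [|Pa]; first exact: QP.
apply: contrapT => Qa.
have [s [As Ps [q Qq [b Bb sq]]]] :
    exists s, [/\ s \in A, ~ P s & addm Q (span B [:: a]) s].
  apply: contrapT => noS; apply: Qa; apply: (Qmax (addm Q (span B [:: a]))).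
  - split; first exact: submodule_addm modQ (submodule_span _ _).
    move=> y [z /(prime_sub pQ) Bz [c Bc /eqP]]; rewrite subr_eq0 => /eqP yz.
    by rewrite -[y](subrK z) yz rpredD // rpredM // AB.
  - by move=> y; exact: addm_subl (submodule_span _ _).
  - by move=> y [Qy [Ay Py]]; apply: noS; exists y.
  - by apply: addm_subr modQ _; apply: mem_span; rewrite mem_head.
have Qs : Q (s - b * a).
  have -> : s - b * a = (s - q - b * a) + q by ring.
  by rewrite sq add0r.
have Bba : b * a \in B by rewrite rpredM // AB.
have [n [c [Ac bn]]] := (integral_closureP A b).1 (BA Bb).
apply: Ps; apply: (@primeX A P s n) => //.
pose w := \sum_(i < n) (c i * a ^+ (n - i)) * s ^+ i.
have Aw : w \in A by apply: rpred_sum => i _; rewrite !rpredM ?rpredX.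
have Pw : P w.
  apply: (submod_sum (prime_mod pP)) => i _.
  apply: (submodZr (prime_mod pP)); first exact: rpredX.
  apply: (submodZ (prime_mod pP)) => //.
  rewrite -(subnSK (ltn_ord i)) exprS.
  by apply: (submodZr (prime_mod pP)) => //; exact: rpredX.
apply: (submod_subB (prime_mod pP) Pw); apply: QP.
  by rewrite rpredB ?rpredX.
have -> : s ^+ n - w = (s ^+ n - (b * a) ^+ n) -
    \sum_(i < n) (c i * a ^+ (n - i)) * (s ^+ i - (b * a) ^+ i).
  under [X in _ = _ - X]eq_bigr do rewrite mulrBr.
  rewrite sumrB [(b * a) ^+ n]exprMn bn mulr_suml.
  have -> : \sum_(i < n) c i * b ^+ i * a ^+ n =
      \sum_(i < n) c i * a ^+ (n - i) * (b * a) ^+ i.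
    apply: eq_bigr => i _.
    have -> : a ^+ n = a ^+ (n - i) * a ^+ i by rewrite -exprD subnK // ltnW.
    by rewrite exprMn; ring.
  by rewrite -/w; ring.
apply: (submodB modQ); first exact: submodXB (AB As) Bba Qs.
apply: (submod_sum modQ) => i _; apply: (submodZ modQ).
  by rewrite rpredM ?rpredX ?AB.
by apply: submodXB modQ (AB As) Bba Qs.
Qed.

Lemma lying_over_exists P : prime_of A P ->
  exists2 Q, prime_of B Q & forall x, x \in A -> Q x <-> P x.
Proof.
move=> pP; have [||Q [pQ _ QP]] := @lying_over [set 0] P pP; last by exists Q.
  split=> [|_ ->]; last exact: rpred0.
  by split=> [//|x y -> ->|a x _ ->]; rewrite ?addr0 ?mulr0.
by move=> x _ ->; exact: (submod0 (prime_mod pP)).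
Qed.

(** Take [a] in [Q] outside [Q0] and a monic equation of [a] modulo [Q0]. Its constant term is in
    [Q] and in [A], hence in [Q0]; cancelling [a] lowers the degree, down to [1] in [Q0]. *)
Lemma incomparable Q0 Q : prime_of B Q0 -> prime_of B Q -> Q0 `<=` Q ->
  (forall x, x \in A -> Q x -> Q0 x) -> Q = Q0.
Proof.
move=> pQ0 pQ Q0Q QQ0; apply/seteqP; split=> // a Qa; apply: contrapT => Q0a.
have Ba := prime_sub pQ Qa.
have [n [c [Ac an]]] := (integral_closureP A a).1 (BA Ba).
have: Q0 (a ^+ n - \sum_(i < n) c i * a ^+ i).
  by rewrite an subrr; exact: submod0 (prime_mod pQ0).
elim: n c Ac {an} => [|n IHn] c Ac.
  by rewrite big_ord0 subr0 => /(prime_proper pQ0).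
have Bsum : a ^+ n - \sum_(i < n) c i.+1 * a ^+ i \in B.
  rewrite rpredB ?rpredX ?rpred_sum // => i _.
  by rewrite rpredM ?rpredX //; apply: AB.
have -> : a ^+ n.+1 - \sum_(i < n.+1) c i * a ^+ i =
    a * (a ^+ n - \sum_(i < n) c i.+1 * a ^+ i) - c 0%N.
  rewrite big_ord_recl expr0 mulr1 mulrBr -exprS mulr_sumr opprD addrA addrAC.
  congr (_ - _ - _); apply: eq_bigr => i _.
  by rewrite mulrCA -exprS.
move=> Q0E; have Q0c : Q0 (c 0%N).
  apply: QQ0 => //; rewrite -[c 0%N]opprK; apply: (submodN (prime_mod pQ)).
  apply: (submod_subD (prime_mod pQ) _ (Q0Q _ _)); last first.
    by rewrite addrC; exact: Q0E.
  exact: (submodZr (prime_mod pQ)).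
have /(primeM pQ0 Ba Bsum)[//|] := submod_subB (prime_mod pQ0) Q0c Q0E.
exact: (IHn (fun i => c i.+1)).
Qed.

End IntegralExtension.

Lemma spanP A l x : span A l x <->
  exists2 c : nat -> K, forall i, c i \in A & x = \sum_(i < size l) c i * l`_i.
Proof.
split=> [|[c Ac ->]]; last first.
  apply: (submod_sum (submodule_span _ _)) => i _.
  by apply: (submodZ (submodule_span _ _)) => //; apply/mem_span/mem_nth.
elim: l x => [|g l IHl] x /=; first by move->; exists (fun=> 0) => [i|];
  rewrite ?rpred0 ?big_ord0.
case=> c Ac /IHl[d Ad xd]; exists (fun i => if i is j.+1 then d j else c).
  by case.
by rewrite big_ord_recl /= -xd addrC subrK.
Qed.

(* Cayley-Hamilton *)
Lemma integral_stable A l x r : r \is a GRing.unit -> span A l r ->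
  (forall y, span A l y -> span A l (x * y)) -> x \in integral_closure A.
Proof.
move=> Ur lr lx; pose n := size l.
have /choice[c cP] (i : 'I_n) : exists c : nat -> K,
    (forall j, c j \in A) /\ x * l`_i = \sum_(j < n) c j * l`_j.
  have /spanP[c Ac xl] := lx _ (mem_span A (mem_nth 0 (ltn_ord i))).
  by exists c.
pose M : 'M[subring_of A]_n := \matrix_(i, j) SubringOf ((cP i).1 j).
rewrite inE; exists (char_poly M); first exact: char_poly_monic.
pose N : 'M[K]_n := \matrix_(i, j) c i j.
have NM : map_mx val M = N by apply/matrixP=> i j; rewrite !mxE.
have detN : (map_poly val (char_poly M)).[x] = \det (x%:M - N).
  rewrite map_char_poly NM /char_poly -horner_evalE -det_map_mx; congr (\det _).
  apply/matrixP=> i j; rewrite !mxE /= horner_evalE hornerD hornerN hornerC.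
  by rewrite hornerMn hornerX.
pose v : 'cV[K]_n := \col_i l`_i.
have Nv : (x%:M - N) *m v = 0.
  apply/matrixP=> i j; rewrite mulmxBl mul_scalar_mx !mxE (cP i).2.
  by rewrite -sumrB big1 // => k _; rewrite !mxE subrr.
have detv i : \det (x%:M - N) * l`_i = 0 :> K.
  have [ltin|leni] := ltnP i n; last by rewrite nth_default ?mulr0.
  have : \adj (x%:M - N) *m ((x%:M - N) *m v) = 0 by rewrite Nv mulmx0.
  rewrite mulmxA mul_adj_mx mul_scalar_mx => /matrixP/(_ (Ordinal ltin) ord0).
  by rewrite !mxE.
apply/rootP; rewrite detN; apply: (mulIr Ur); rewrite mul0r.
have /spanP[d _ ->] := lr; rewrite mulr_sumr big1 // => i _.
by rewrite mulrCA detv mulr0.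
Qed.

End Primes.

(** * Regular quotient rings *)

Section PrimeSets.

Variable K : comUnitRingType.
Implicit Types (A B : subringClosed K) (P : set K).

(** Primes of different subrings live in different types; as subsets of [K] they can be compared and
    intersected. *)
Definition prime_set A (Q : prime_idealr (subring_of A)) : set K :=
  [set x | exists2 q, q \in Q & val q = x].

Lemma prime_setE A (Q : prime_idealr (subring_of A)) q :
  prime_set Q (val q) <-> q \in Q.
Proof. by split=> [[q' Qq' /val_inj<-]|Qq] //; exists q. Qed.

Lemma prime_of_prime_set A (Q : prime_idealr (subring_of A)) :
  prime_of A (prime_set Q).
Proof.
split=> [|x [q _ <-]|[q Qq q1]|x y Ax Ay].
- split=> [|x y [q Qq <-] [r Qr <-]|a x Aa [q Qq <-]].
  + by exists 0; rewrite ?rpred0.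
  + by exists (q + r); rewrite ?rpredD.
  + by exists (SubringOf Aa * q); rewrite ?idealMr.
- exact: subring_valP.
- by have := idealr1 Q; rewrite -(_ : q = 1) ?Qq //; apply: val_inj.
- case=> q Qq /= qxy; have : SubringOf Ax * SubringOf Ay \in Q.
    by rewrite -(_ : q = SubringOf Ax * SubringOf Ay) //; apply: val_inj.
  rewrite prime_idealrM => /orP[Qx|Qy].
    by left; exists (SubringOf Ax).
  by right; exists (SubringOf Ay).
Qed.

Lemma prime_set_inj A (Q Q' : prime_idealr (subring_of A)) :
  prime_set Q = prime_set Q' -> Q = Q'.
Proof.
move=> QQ'; apply: prime_idealr_ext => q.
by apply/idP/idP => /prime_setE; [rewrite QQ' | rewrite -QQ'] => /prime_setE.
Qed.

Section OfSet.

Variables (A : subringClosed K) (P : set K) (pP : prime_of A P).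

Definition prime_pred of prime_of A P : {pred subring_of A} :=
  [pred x | `[< P (val x) >]].

Fact prime_pred_idealr : idealr_closed (prime_pred pP).
Proof.
split=> [||a u v]; rewrite !inE; first exact: submod0 (prime_mod pP).
  by apply/asboolPn; exact: prime_proper pP.
move=> Pu Pv; apply: (submodD (prime_mod pP)) => //.
by apply: (submodZ (prime_mod pP)) => //; exact: subring_valP.
Qed.

Fact prime_pred_prime : prime_idealr_closed (prime_pred pP).
Proof.
move=> u v; rewrite !inE => Puv; apply/orP.
by have [] := primeM pP (subring_valP u) (subring_valP v) Puv; [left | right];
  apply/asboolP.
Qed.

HB.instance Definition _ :=
  isIdealr.Build (subring_of A) (prime_pred pP) prime_pred_idealr.
HB.instance Definition _ :=
  isPrimeIdealrClosed.Build (subring_of A) (prime_pred pP) prime_pred_prime.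

Lemma prime_set_exists : exists Q :
  prime_idealr (subring_of A), prime_set Q = P.
Proof.
exists (prime_pred pP); apply/seteqP; split=> [x [q] |x Px].
  by rewrite inE => Pq <-.
by exists (SubringOf (prime_sub pP Px)); rewrite ?inE.
Qed.

End OfSet.

Lemma prime_set_spec_map A B (AB : {subset A <= B})
    (Q : prime_idealr (subring_of B)) :
  prime_set (spec_map (incl AB) Q) = [set` A] `&` prime_set Q.
Proof.
apply/seteqP; split=> [x [q]|x [/= Ax [q Qq qx]]].
  by rewrite inE => Qq <-; split; [exact: subring_valP | exists (incl AB q)].
exists (SubringOf Ax) => //; suff: incl AB (SubringOf Ax) \in Q by [].
by rewrite (_ : incl _ _ = q) //; exact: val_inj.
Qed.

End PrimeSets.

(** * Maximal annihilators and regular translates *)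

Section TotalQuotientRing.

Variables (K : comUnitRingType) (A : subringClosed K).
Hypothesis A_K : is_total_quotient_ring A.

Lemma lreg_unit (s : subring_of A) : GRing.lreg s <-> val s \is a GRing.unit.
Proof.
split=> [|Us x y sxy]; first exact: A_K.1.
by apply/val_inj/(mulrI Us); exact: (congr1 val sxy).
Qed.

Lemma nonzerodiv_unit s : s \in A -> (forall x, x \in A -> x * s = 0 -> x = 0)
  ->
  s \is a GRing.unit.
Proof.
move=> As s0; rewrite (_ : s = val (SubringOf As)) //; apply/lreg_unit.
move=> x y sxy; apply/eqP; rewrite -subr_eq0; apply/eqP/val_inj; apply: s0.
  exact: subring_valP.
by rewrite (_ : s = val (SubringOf As)) // -rmorphM mulrC mulrBr sxy subrr.
Qed.

Lemma fracP x : exists s, [/\ s \in A, s \is a GRing.unit & x * s \in A].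
Proof.
have [a [s [/lreg_unit Us ->]]] := A_K.2 x.
by exists (val s); rewrite divrK //; split=> //; exact: subring_valP.
Qed.

Lemma regular_quotientP (P : prime_idealr (subring_of A)) x :
  x \in regular_quotient P <->
  exists s, [/\ s \in A, ~ prime_set P s, s \is a GRing.unit & x * s \in A].
Proof.
rewrite inE; split=> [[a [s [Ps /lreg_unit Us xs]]]|[s [As Ps Us xs]]].
  exists (val s); rewrite xs; split=> //; try exact: subring_valP.
  by move/prime_setE; apply/negP.
exists (SubringOf xs), (SubringOf As); split=> //; last exact/lreg_unit.
by apply/negP => /prime_setE.
Qed.

Lemma sub_regular_quotient (P : prime_idealr (subring_of A)) :
  {subset A <= regular_quotient P}.
Proof.
move=> x Ax; apply/regular_quotientP; exists 1.
rewrite rpred1 unitr1 mulr1; split=> //.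
exact: prime_proper (prime_of_prime_set P).
Qed.

Section Noetherian.

Hypothesis noeA : noeth A.

Definition ann z : set K := [set a | a \in A /\ a * z = 0].

Lemma ideal_ann z : ideal_of A (ann z).
Proof.
split=> [|x []//]; split=> [|x y [Ax xz] [Ay yz]|a x Aa [Ax xz]].
- by split; rewrite ?rpred0 ?mul0r.
- by split; rewrite ?rpredD // mulrDl xz yz addr0.
- by split; rewrite ?rpredM // -mulrA xz mulr0.
Qed.

Definition max_ann : set K := [set z | [/\ z \in A, z != 0 &
  forall w, w \in A -> w != 0 -> ann z `<=` ann w -> ann w = ann z]].

Lemma max_annP c : c \in A -> c != 0 -> exists2 z, max_ann z & ann c `<=` ann z.
Proof.
move=> Ac c0.
pose F I := exists w, [/\ w \in A, w != 0, ann c `<=` ann w & I = ann w].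
have [||_ [z [Az z0 cz ->]] zmax] := @noeth_maximal _ A F (ann c) noeA.
- by move=> _ [w [_ _ _ ->]]; exact: ideal_ann.
- by exists c; split=> // x.
exists z => //; split=> // w Aw w0 zw; apply: zmax => //.
by exists w; split=> //; apply: subset_trans zw.
Qed.

Lemma prime_max_ann z : max_ann z -> prime_of A (ann z).
Proof.
move=> [Az z0 zmax]; split; try by case: (ideal_ann z).
  by case=> _; rewrite mul1r; apply/eqP.
move=> x y Ax Ay [Axy xyz].
have [yz|yz] := eqVneq (y * z) 0; [by right | left].
suff <- : ann (y * z) = ann z by split=> //; rewrite mulrA.
apply: zmax => // [|a [Aa az]]; first exact: rpredM.
by split=> //; rewrite mulrCA az mulr0.
Qed.

Lemma prime_avoid (T : eqType) (l : seq T) (F : T -> set K) P :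
  prime_of A P -> (forall w, w \in l -> ideal_of A (F w)) ->
  (forall w, w \in l -> ~ F w `<=` P) ->
  exists e, [/\ e \in A, ~ P e & forall w, w \in l -> F w e].
Proof.
move=> pP; elim: l => [|w l IHl] Fid FP.
  by exists 1; rewrite rpred1; split=> //; exact: prime_proper pP.
have [||e [Ae Pe Fe]] := IHl.
- by move=> v vl; apply: Fid; rewrite inE vl orbT.
- by move=> v vl; apply: FP; rewrite inE vl orbT.
have [modw wA] := Fid w (mem_head _ _).
have /existsNP[d /not_implyP[wd Pd]] := FP w (mem_head _ _).
exists (d * e); split.
- by rewrite rpredM // wA.
- by apply: (primeMn pP) => //; exact: wA.
- move=> v; rewrite inE => /predU1P[->|vl]; first exact: (submodZr modw).
  have [modv _] := Fid v (mem_behead (s := w :: l) vl).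
  by apply: (submodZ modv (wA _ wd)); exact: Fe.
Qed.

(* The maximal annihilators are the ann w with w in a finite list L, any list *)
(* of elements z of max_ann that spans them all.                              *)
Lemma max_ann_finite : exists2 L : seq K, forall w, w \in L -> max_ann w &
  forall z, max_ann z -> exists2 w, w \in L & ann w = ann z.
Proof.
pose D := [set x | exists2 l :
  seq K, forall w, w \in l -> max_ann w & span A l x].
have modD : submodule A D.
  split=> [|x y [l lm lx] [l' lm' ly]|a x Aa [l lm lx]].
  - by exists [::].
  - exists (l ++ l'); first by move=> w; rewrite mem_cat => /orP[/lm|/lm'].
    by apply/span_cat/addmI.
  - by exists l => //; apply: (submodZ (submodule_span _ _)).
have [|gs Dgs] := noeA modD.
  move=> x [l lm]; apply: (span_min (submodule_subring A)) => w /lm[].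
  by [].
have [L Lm LD] : exists2 L : seq K, forall w, w \in L -> max_ann w &
    forall g, g \in gs -> span A L g.
  have : forall g, g \in gs -> D g by move=> g; rewrite Dgs; exact: mem_span.
  elim: (gs) => [|g l IHl] lD; first by exists [::].
  have [|L Lm Ll] := IHl; first by move=> h hl; apply: lD; rewrite inE hl orbT.
  have [L' Lm' L'g] := lD g (mem_head _ _).
  exists (L' ++ L) => [w|h]; first by rewrite mem_cat => /orP[/Lm'|/Lm].
  rewrite inE => /predU1P[->|/Ll Lh]; apply/span_cat.
    exact: addm_subl (submodule_span _ _) L'g.
  exact: addm_subr (submodule_span _ _) Lh.
exists L => // z mz; apply: contrapT => noL.
have [|w wL|e [Ae ez eL]] := prime_avoid (l := L) (F := ann) (prime_max_ann mz).
- by move=> w _; exact: ideal_ann.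
- move=> wz; apply: noL; exists w => //; symmetry.
  by have [Az z0 _] := mz; have [_ _] := Lm _ wL; apply.
have : span A L z.
  apply: (span_min (submodule_span A L) LD); rewrite -Dgs.
  by exists [:: z]; [move=> w; rewrite inE => /eqP-> | exact/mem_span/mem_head].
move=> Lz; apply: ez; split=> //.
apply: (span_min (submodule_preimM e (M := [set 0]) _) _ Lz) => [|w /eL[]//].
by split=> [//|x y -> ->|a x _ ->]; rewrite ?addr0 ?mulr0.
Qed.

(** The zero divisors of [A] are covered by finitely many maximal annihilators, which are primes not
    containing [s]. Prime avoidance, by induction on their list, finds an element of the coset
    outside all of them. *)
Lemma regular_translate a s : a \in A -> s \in A -> s \is a GRing.unit ->
  exists2 y, y \in A & a + s * y \is a GRing.unit.
Proof.
move=> Aa As Us; have [L Lm Lall] := max_ann_finite.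
suff [y Ay yL] : exists2 y, y \in A & forall w, w \in L -> ~ ann w (a + s * y).
  exists y => //; apply: nonzerodiv_unit; first by rewrite rpredD ?rpredM.
  move=> c Ac cay; apply/eqP; apply: contrapT => /negP c0.
  have [z mz cz] := max_annP Ac c0; have [w wL wz] := Lall z mz.
  apply: (yL w wL); rewrite wz; apply: cz; split; last by rewrite mulrC.
  by rewrite rpredD ?rpredM.
elim: L Lm {Lall} => [|z L IHL] Lm; first by exists 0; rewrite ?rpred0.
have Lm' w : w \in L -> max_ann w by move=> wL; apply: Lm; rewrite inE wL orbT.
have [y Ay yL] := IHL Lm'.
have [zy|] := pselect (ann z (a + s * y)); last first.
  by move=> zy; exists y => // w; rewrite inE => /predU1P[->|/yL].
have mz := Lm z (mem_head _ _).
have [|w wL wz|e [Ae ze eL]] := prime_avoid (l := L) (F :=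
  ann) (prime_max_ann mz).
- by move=> w _; exact: ideal_ann.
- have [Az z0 _] := mz; have [_ _ /(_ z Az z0 wz) zw] := Lm' _ wL.
  by apply: (yL w wL); rewrite -zw.
(* [e] lies in all the earlier annihilators but not in [ann z], so adding [s * e] repairs the
   failure at [z] and changes nothing at the others. *)
exists (y + e) => [|w]; first exact: rpredD.
rewrite mulrDr addrA inE => /predU1P[->|wL Aw].
  rewrite addrC => /(submod_subD (ideal_ann z).1 zy)[_ sez]; apply: ze.
  by split=> //; apply: (mulrI Us); rewrite mulrA sez mulr0.
apply: (yL w wL); apply: (submod_subD (ideal_ann w).1 _ Aw).
exact: (submodZ (ideal_ann w).1 As (eL w wL)).
Qed.

End Noetherian.

End TotalQuotientRing.

(** * The regular quotient ring at a prime *)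

Section LocalRing.

Variables (K : comUnitRingType) (A : subringClosed K).
Hypotheses (A_K : is_total_quotient_ring A) (noeA : noeth A).
Variable P : prime_idealr (subring_of A).

Notation R := (regular_quotient P).
Notation pP := (prime_of_prime_set P).

Lemma unit_inv_regular_quotient s :
  s \in A -> ~ prime_set P s -> s \is a GRing.unit -> s^-1 \in R.
Proof.
by move=> As Ps Us; apply/(regular_quotientP A_K); exists s;
  rewrite mulVr ?rpred1.
Qed.

Lemma noeth_regular_quotient : noeth R.
Proof.
move=> I modI IR; have AR := sub_regular_quotient A_K P.
have [||l Il] := noeA (I := I `&` [set` A]).
- exact: submodule_setI (submodS AR modI) (submodule_subring A).
- by move=> x [].
exists l; apply/seteqP; split=> x.
  move=> Ix; have /(regular_quotientP A_K)[s [As Ps Us Axs]] := IR _ Ix.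
  rewrite -[x](mulrK Us); apply: (submodZr (submodule_span _ _)).
    exact: unit_inv_regular_quotient.
  have : span A l (x * s) by rewrite -Il; split=> //; apply: (submodZr modI);
    rewrite // AR.
  exact: span_subset.
apply: (span_min modI) => g gl.
by have : (I `&` [set` A]) g; [rewrite Il; exact: mem_span | case].
Qed.

(** The extension of [P] to [R]. The ring [R] may have other maximal ideals, but for regular [P]
    this one is maximal by [local_max_inv]. *)
Definition local_max : set K :=
  [set x | exists s, [/\ s \in A, ~ prime_set P s, s \is a GRing.unit
                       & prime_set P (x * s)]].

Lemma local_max_sub x : x \in A -> local_max x -> prime_set P x.
Proof. by move=> Ax [s [As Ps Us]] /(primeM pP Ax As)[]. Qed.

Lemma sub_local_max x : prime_set P x -> local_max x.
Proof.
move=> Px; exists 1; rewrite rpred1 unitr1 mulr1; split=> //.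
exact: prime_proper pP.
Qed.

Lemma prime_local_max : prime_of R local_max.
Proof.
split=> [|x [s [As Ps Us Pxs]]|[s [_ Ps _]]|x y].
- split=> [|x y [s [As Ps Us Pxs]] [t [At Pt Ut Pyt]]|a x].
  + by apply/sub_local_max/(submod0 (prime_mod pP)).
  + exists (s * t); rewrite rpredM ?unitrMl //; split=> //.
      exact: (primeMn pP).
    have -> : (x + y) * (s * t) = t * (x * s) + s * (y * t) by ring.
    apply: (submodD (prime_mod pP)); exact: (submodZ (prime_mod pP)).
  + move=> /(regular_quotientP A_K)[t [At Pt Ut Aat]] [s [As Ps Us Pxs]].
    exists (s * t); rewrite rpredM ?unitrMl //; split=> //.
      exact: (primeMn pP).
    have -> : a * x * (s * t) = (a * t) * (x * s) by ring.
    exact: (submodZ (prime_mod pP)).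
- by apply/(regular_quotientP A_K); exists s; split=> //; exact: (prime_sub pP).
- by rewrite mul1r.
- move=> /(regular_quotientP A_K)[s [As Ps Us Axs]].
  move=> /(regular_quotientP A_K)[t [At Pt Ut Ayt]] [u [Au Pu Uu Pxyu]].
  have : prime_set P ((x * s) * ((y * t) * u)).
    have -> : (x * s) * ((y * t) * u) = (s * t) * (x * y * u) by ring.
    by apply: (submodZ (prime_mod pP)) => //; rewrite rpredM.
  case/(primeM pP) => //; first by rewrite rpredM.
    by left; exists s.
  by case/(primeM pP) => // Pyt; right; exists t.
Qed.

(** A numerator of [c] is translated by a multiple of [r] into a unit of [K]; it stays outside [P],
    so it is invertible in [R], and [c] is invertible modulo the extension of [P]. *)
Lemma local_max_inv r c : prime_set P r -> r \is a GRing.unit ->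
  c \in R -> ~ local_max c -> exists2 c', c' \in R & local_max (1 - c * c').
Proof.
move=> Pr Ur /(regular_quotientP A_K)[s [As Ps Us Acs]] mc.
have Ar := prime_sub pP Pr.
have Pcs : ~ prime_set P (c * s) by move=> Pcs; apply: mc; exists s.
have [y Ay Ue] := regular_translate A_K noeA Acs Ar Ur.
have Ae : c * s + r * y \in A by rewrite rpredD // rpredM.
have Pry : prime_set P (r * y) by apply: (submodZr (prime_mod pP)).
have Pe : ~ prime_set P (c * s + r * y).
  by move/(submod_subD (prime_mod pP) Pry).
exists (s * (c * s + r * y)^-1).
  by rewrite rpredM ?unit_inv_regular_quotient ?sub_regular_quotient.
exists (c * s + r * y); split=> //.
by rewrite mulrBl mul1r !mulrA divrK // addrC addKr.
Qed.

Lemma common_denominator n (c : nat -> K) : (forall i, c i \in R) ->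
  exists s, [/\ s \in A, ~ prime_set P s, s \is a GRing.unit
              & forall i, (i < n)%N -> c i * s \in A].
Proof.
move=> Rc; elim: n => [|n [s [As Ps Us Acs]]].
  by exists 1; rewrite rpred1 unitr1; split=> //; exact: prime_proper pP.
have /(regular_quotientP A_K)[t [At Pt Ut Act]] := Rc n.
exists (s * t); rewrite rpredM ?unitrMl //; split=> //.
  exact: (primeMn pP).
move=> i; rewrite ltnS leq_eqVlt => /predU1P[->|/Acs Aci].
  by rewrite mulrCA rpredM.
by rewrite mulrA rpredM.
Qed.

Lemma integral_local x : x \in integral_closure R <->
  exists s, [/\ s \in A, ~ prime_set P s, s \is a GRing.unit
              & x * s \in integral_closure A].
Proof.
have AR := sub_regular_quotient A_K P.
split=> [/integral_closureP[n [c [Rc xn]]]|[s [As Ps Us xs]]]; last first.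
  rewrite -[x](mulrK Us) rpredM //; first exact: integral_closureS xs.
  by apply: sub_integral_closure; exact: unit_inv_regular_quotient.
have [s [As Ps Us Acs]] := common_denominator n Rc.
exists s; split=> //; apply/integral_closureP.
exists n, (fun i => if (i < n)%N then c i * s ^+ (n - i) else 0); split=> [i|].
  case: ltnP => [ltin|_]; last exact: rpred0.
  by rewrite -(subnSK ltin) exprS mulrA rpredM ?rpredX ?Acs.
rewrite exprMn xn mulr_suml; apply: eq_bigr => i _; rewrite ltn_ord.
have -> : s ^+ n = s ^+ (n - i) * s ^+ i by rewrite -exprD subnK // ltnW.
by rewrite exprMn; ring.
Qed.

End LocalRing.

(** * A theorem of Matijevic *)

Section FiniteExtensions.

Variable K : comUnitRingType.
Implicit Types (R : subringClosed K) (l s : seq K).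

Definition subring_set (S : set K) :=
  [/\ S 1, forall x y, S x -> S y -> S (x - y)
    & forall x y, S x -> S y -> S (x * y)].

Section OfSet.

Variables (S : set K) (ringS : subring_set S).

Definition subring_pred of subring_set S : {pred K} := [pred x | `[< S x >]].

Fact subring_pred_subring : subring_closed (subring_pred ringS).
Proof.
by case: ringS => S1 SB SM; split=> [|x y|x y]; rewrite !inE //;
  [apply: SB | apply: SM].
Qed.

HB.instance Definition _ :=
  GRing.isSubringClosed.Build K (subring_pred ringS) subring_pred_subring.

Lemma subring_exists : exists B : subringClosed K, forall x, x \in B <-> S x.
Proof. by exists (subring_pred ringS : subringClosed K) => x; rewrite inE. Qed.

End OfSet.

Lemma span_map R l c x : span R l x -> span R [seq c * g | g <- l] (c * x).
Proof.
apply: (span_min (submodule_preimM c (submodule_span _ _))) => g gl.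
by apply/mem_span/map_f.
Qed.

(** The elements are adjoined one at a time: the powers of [x] below the degree of an integral
    equation, times the old generators, span the new ring. *)
Lemma finite_subring R s : (forall x, x \in s -> x \in integral_closure R) ->
  exists l, [/\ subring_set (span R l), forall x, x \in s -> span R l x
              & forall x, span R l x -> x \in integral_closure R].
Proof.
elim: s => [_|x s IHs Rs].
  have R1 x : span R [:: 1] x <-> x \in R.
    split=> [|Rx]; last by exists x; rewrite //= mulr1 subrr.
    by apply: (span_min (submodule_subring R)) => g; rewrite inE => /eqP->;
      exact: rpred1.
  exists [:: 1]; split=> // [|x /R1]; last exact: sub_integral_closure.
  split=> [|x y|x y]; rewrite ?R1; first exact: rpred1.
    exact: rpredB.
  exact: rpredM.
have [|l [[l1 lB lM] sl lR]] := IHs; first by move=> z zs; apply: Rs;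
  rewrite inE zs orbT.
have /integral_closureP[n [c [Rc xn]]] := Rs x (mem_head _ _).
have n0 : (0 < n)%N.
  by case: n xn => // /eqP; rewrite big_ord0 expr0 oner_eq0.
pose l' := [seq g * x ^+ i | g <- l, i <- iota 0 n].
have mod' := submodule_span R l'.
have l'x g i : span R l g -> (i < n)%N -> span R l' (g * x ^+ i).
  move=> lg ltin; rewrite mulrC.
  apply: (span_min (submodule_preimM (x ^+ i) mod') _ lg) => h hl /=.
  by rewrite mulrC; apply/mem_span/allpairsP; exists (h, i); rewrite mem_iota.
have ll' g : span R l g -> span R l' g.
  by move=> lg; rewrite -[g]mulr1 -(expr0 x); apply: l'x.
have l'M z : span R l' z -> span R l' (x * z).
  apply: (span_min (submodule_preimM x mod')) =>
    _ /allpairsP[[g i] /= [gl + ->]].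
  rewrite mem_iota add0n => /= ltin; rewrite mulrCA -exprS.
  have lg := mem_span R gl.
  move: ltin; rewrite leq_eqVlt => /predU1P[->|ltin]; last exact: l'x.
  rewrite xn mulr_sumr; apply: (submod_sum mod') => j _.
  by rewrite mulrCA; apply: (submodZ mod') => //; apply: l'x.
have l'Ml z g : span R l' z -> span R l g -> span R l' (z * g).
  move=> l'z lg; rewrite mulrC.
  apply: (span_min (submodule_preimM g mod') _ l'z) =>
    _ /allpairsP[[h i] /= [hl + ->]].
  rewrite mem_iota add0n => /= ltin; rewrite mulrA; apply: l'x => //.
  by apply: lM => //; exact: mem_span.
have l'MX z i : span R l' z -> span R l' (z * x ^+ i).
  move=> l'z; elim: i => [|i IHi]; first by rewrite mulr1.
  by rewrite exprS mulrCA; apply: l'M.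
exists l'; split=> [|z|z].
- split=> [|z w|z w l'z]; first exact: ll'.
    exact: (submodB mod').
  apply: (span_min (submodule_preimM z mod')) =>
    _ /allpairsP[[g i] /= [gl _ ->]].
  by rewrite mulrA; apply/l'MX/l'Ml => //; exact: mem_span.
- rewrite inE => /predU1P[->|/sl/ll' //].
  by rewrite -[x]mulr1; apply/l'M/ll'.
- apply: (span_min (submodS (@sub_integral_closure _ R) (submodule_subring _))).
  move=> _ /allpairsP[[g i] /= [gl _ ->]]; rewrite rpredM ?rpredX //.
    by apply: lR; exact: mem_span.
  by apply: Rs; exact: mem_head.
Qed.

End FiniteExtensions.

(** * Descending chains modulo a maximal ideal *)

Section DescendingChains.

Variables (K : comUnitRingType) (R : subringClosed K) (m : set K).
Hypotheses (noeR : noeth R) (pm : prime_of R m).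
Hypothesis m_inv : forall c, c \in R -> ~ m c ->
  exists2 c', c' \in R & m (1 - c * c').
Implicit Types (M N : set K) (l : seq K).

(** The descending chain condition on the quotient of [M] by [N], stated without forming
    quotients. *)
Definition dcc N M := forall H : nat -> set K,
  (forall n, submodule R (H n)) -> (forall n, H n.+1 `<=` H n) ->
  (forall n, N `<=` H n) -> (forall n, H n `<=` M) ->
  exists n0, forall n, (n0 <= n)%N -> H n0 `<=` H n.

Lemma decreasing_le (H : nat -> set K) n n' :
  (forall n, H n.+1 `<=` H n) -> (n <= n')%N -> H n' `<=` H n.
Proof.
move=> HS; elim: n' => [|n' IHn]; first by rewrite leqn0 => /eqP->.
rewrite leq_eqVlt => /predU1P[<-//|/IHn]; exact: subset_trans.
Qed.

Lemma dccS N M M' : M' `<=` M -> dcc N M -> dcc N M'.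
Proof.
by move=> M'M NM H modH HS NH HM; apply: NM => // n; apply: subset_trans M'M.
Qed.

Lemma dcc_trans N M L : submodule R M -> submodule R L -> N `<=` M -> M `<=` L
  ->
  dcc N M -> dcc M L -> dcc N L.
Proof.
move=> modM modL NM ML dNM dML H modH HS NH HL.
have [||||n1 n1P] := dNM (fun n => H n `&` M).
- by move=> n; exact: submodule_setI.
- by move=> n x [/HS].
- by move=> n x Nx; split; [apply: NH | apply: NM].
- by move=> n x [].
have [||||n2 n2P] := dML (fun n => addm (H n) M).
- by move=> n; exact: submodule_addm.
- by move=> n x [z /HS Hz Mxz]; exists z.
- by move=> n x; exact: addm_subr.
- move=> n x [z /HL Lz /ML Lxz]; exact: (submod_subB modL Lz).
exists (maxn n1 n2) => n; rewrite geq_max => /andP[len1 len2] x Hx.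
have [z Hz Mxz] : addm (H n) M x.
  apply: (n2P n len2); exists x; last by rewrite subrr; exact: submod0 modM.
  exact: decreasing_le HS (leq_maxr _ _) _ Hx.
apply: (submod_subB (modH n) Hz).
suff [] : (H n `&` M) (x - z) by [].
apply: (n1P n len1); split=> //.
apply: (submodB (modH n1)); first exact: decreasing_le HS (leq_maxl _ _) _ Hx.
exact: decreasing_le HS len1 _ Hz.
Qed.

(** The quotient is cyclic and killed by the maximal ideal [m], so it is zero or simple: a chain
    that never falls to [N] always contains [h]. *)
Lemma dcc_cyclic N h : submodule R N -> (forall a, m a -> N (a * h)) ->
  dcc N (addm N (span R [:: h])).
Proof.
move=> modN mh H modH HS NH HM.
have [[n HN]|noN] := pselect (exists n, H n `<=` N).
  by exists n => k _; apply: subset_trans HN _.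
exists 0%N => n _; apply: subset_trans (HM 0%N) _ => x [z Nz [c Rc /eqP]].
rewrite subr_eq0 => /eqP xz; apply: (submod_subB (modH n) (NH n _ Nz)).
rewrite xz; apply: (submodZ (modH n)) => // {x z Nz c Rc xz}.
have /existsNP[x /not_implyP[Hx Nx]] : ~ H n `<=` N by move=> HN; apply: noN;
  exists n.
have [z Nz [c Rc /eqP]] := HM n x Hx; rewrite subr_eq0 => /eqP xz.
have [c' Rc' mc'] : exists2 c', c' \in R & m (1 - c * c').
  apply: m_inv => // mc; apply: Nx; apply: (submod_subB modN Nz).
  by rewrite xz; exact: mh.
have -> : h = (1 - c * c') * h + c' * (c * h) by ring.
apply: (submodD (modH n)); first by apply: NH; exact: mh.
apply: (submodZ (modH n)) => //; rewrite -xz.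
apply: (submodB (modH n)) => //; exact: NH.
Qed.

Lemma dcc_span N l : submodule R N ->
  (forall g a, g \in l -> m a -> N (a * g)) -> dcc N (addm N (span R l)).
Proof.
move=> modN; elim: l => [|g l IHl] ml.
  move=> H _ _ NH HN; exists 0%N => n _ x /HN[z Nz] /= /eqP.
  by rewrite subr_eq0 => /eqP->; exact: NH.
have mod_l := submodule_addm modN (submodule_span R l).
have NNl : N `<=` addm N (span R l).
  by move=> x; exact: addm_subl (submodule_span _ _).
apply: (@dccS _ (addm (addm N (span R l)) (span R [:: g]))).
  move=> x [z Nz [c Rc lx]]; exists (x - c * g); last first.
    by exists c => //=; ring.
  by exists z => //; move: lx; rewrite addrAC.
apply: (dcc_trans mod_l _ NNl).
- exact: submodule_addm mod_l (submodule_span _ _).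
- by move=> x; exact: addm_subl (submodule_span _ _).
- by apply: IHl => h a hl; apply: ml; rewrite inE hl orbT.
- apply: (dcc_cyclic mod_l) => a ma; apply: NNl; apply: ml => //;
    exact: mem_head.
Qed.

(** The elements that the [k]-th power of [m] multiplies into [N], with that power replaced by [k]
    successive multiplications. *)
Fixpoint tors N k (x : K) : Prop :=
  if k is k'.+1 then forall a, m a -> tors N k' (a * x) else N x.

Lemma submodule_tors N k : submodule R N -> submodule R (tors N k).
Proof.
move=> modN; elim: k => [//|k IHk]; split=> [a _|x y Nx Ny a ma|b x Rb Nx a ma].
- by rewrite mulr0; exact: submod0 IHk.
- by rewrite mulrDr; apply: (submodD IHk); [apply: Nx | apply: Ny].
- by rewrite mulrCA; apply: (submodZ IHk) => //; apply: Nx.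
Qed.

Lemma tors_le N k k' x : submodule R N -> (k <= k')%N ->
  tors N k x -> tors N k' x.
Proof.
move=> modN; elim: k' => [|k' IHk]; first by rewrite leqn0 => /eqP->.
rewrite leq_eqVlt => /predU1P[->//|/IHk{}IHk /IHk Nx a ma].
by apply: (submodZ (submodule_tors k' modN)) => //; exact: (prime_sub pm).
Qed.

Lemma tors_uniform N (l : seq K) : submodule R N ->
  (forall g, g \in l -> exists k, tors N k g) ->
  exists k, forall g, g \in l -> tors N k g.
Proof.
move=> modN; elim: l => [|g l IHl] lN; first by exists 0%N.
have [|k kP] := IHl; first by move=> h hl; apply: lN; rewrite inE hl orbT.
have [k' Nk'g] := lN g (mem_head _ _).
exists (maxn k k') => h; rewrite inE => /predU1P[->|/kP].
  exact: tors_le modN (leq_maxr _ _) Nk'g.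
exact: tors_le modN (leq_maxl _ _).
Qed.

(** Induction on [k] through the intermediate module generated over [N] by [m] times [l]: it is
    finitely generated because [m] is, and has smaller torsion exponent, while the top quotient is
    killed by [m]. *)
Lemma dcc_tors N k l : submodule R N -> (forall g, g \in l -> tors N k g) ->
  dcc N (addm N (span R l)).
Proof.
move=> modN; elim: k l => [|k IHk] l lN.
  by apply: dcc_span => // g a /lN Ng ma; apply: (submodZ modN) => //;
    exact: (prime_sub pm).
have [|lm mlm] := noeR (prime_mod pm); first by move=> x; exact: (prime_sub pm).
pose l' := [seq a * g | a <- lm, g <- l].
have mod' := submodule_addm modN (submodule_span R l').
have NN' : N `<=` addm N (span R l').
  by move=> x; exact: addm_subl (submodule_span _ _).
apply: (@dccS _ (addm (addm N (span R l')) (span R l))).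
  by move=> x [z /NN' Nz lxz]; exists z.
apply: (dcc_trans mod' _ NN').
- exact: submodule_addm mod' (submodule_span _ _).
- by move=> x; exact: addm_subl (submodule_span _ _).
- apply: IHk => _ /allpairsP[[a g] /= [alm /lN Ng ->]].
  by apply: Ng; rewrite mlm; exact: mem_span.
- apply: (dcc_span mod') => g a gl; rewrite mlm => lma.
  apply: addm_subr modN _; rewrite mulrC.
  apply: (span_min (submodule_preimM g (submodule_span _ _)) _ lma) => b blm /=.
  by rewrite mulrC; apply/mem_span/allpairsP; exists (b, g).
Qed.

(** * Matijevic's argument for the ideal transform of a finite extension *)

Section Transform.

Variables (l1 : seq K) (T : subringClosed K).
Notation R1 := (span R l1).
Hypothesis ringR1 : subring_set R1.
Hypothesis R1_int : forall x, R1 x -> x \in integral_closure R.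
Hypothesis TP : forall x,
  x \in T <-> x \in integral_closure R /\ exists k, tors R1 k x.

Let mod1 : submodule R R1 := submodule_span R l1.

Lemma transform_int : {subset T <= integral_closure R}.
Proof. by move=> x /TP[]. Qed.

Lemma sub_transform x : R1 x -> x \in T.
Proof. by move=> R1x; apply/TP; split; [exact: R1_int | exists 0%N]. Qed.

Lemma ring_sub_transform : {subset R <= T}.
Proof.
move=> x Rx; apply: sub_transform; rewrite -[x]mulr1;
  apply: (submodZ mod1) => //.
by case: ringR1.
Qed.

(* The R-modules t ^+ n.+1 T + t R1, cut down to R1, form a descending chain  *)
(* between t R1 and a module that is finitely generated and m-power torsion   *)
(* modulo t R1; where the chain is stationary one can divide by t.            *)
Lemma transform_mod_finite t : m t -> t \is a GRing.unit ->
  exists2 l, forall x, span R l x -> x \in T &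
    forall x, x \in T -> exists2 z, z \in T & span R l (x - t * z).
Proof.
move=> mt Ut; have Rt := prime_sub pm mt; have Tt := ring_sub_transform Rt.
pose H n := [set h | R1 h /\
  exists z r, [/\ z \in T, R1 r & h = t ^+ n.+1 * z + t * r]].
pose N := [set x | exists2 r, R1 r & x = t * r].
have modN : submodule R N.
  split=> [|_ _ [r Rr ->] [s Rs ->]|a _ Ra [r Rr ->]].
  - by exists 0; rewrite ?mulr0 //; exact: submod0 mod1.
  - by exists (r + s); rewrite ?mulrDr //; exact: (submodD mod1).
  - by exists (a * r); rewrite 1?mulrCA //; exact: (submodZ mod1).
have modH n : submodule R (H n).
  split=> [|x y [R1x [z [r [Tz Rr xz]]]] [R1y [w [s [Tw Rs yw]]]]
      |a x Ra [R1x [z [r [Tz Rr xz]]]]].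
  - split; first exact: submod0 mod1.
    exists 0, 0; rewrite rpred0 !mulr0 addr0; split=> //; exact: submod0 mod1.
  - split; first exact: (submodD mod1).
    exists (z + w), (r + s); rewrite rpredD //; split=> //.
      exact: (submodD mod1).
    by rewrite xz yw; ring.
  - split; first exact: (submodZ mod1).
    exists (a * z), (a * r); rewrite rpredM //; last exact: ring_sub_transform.
    split=> //.
      exact: (submodZ mod1).
    by rewrite xz; ring.
have HS n : H n.+1 `<=` H n.
  move=> x [R1x [z [r [Tz Rr xz]]]]; split=> //.
  exists (t * z), r; rewrite rpredM //; split=> //.
  by rewrite xz exprSr; ring.
have NH n : N `<=` H n.
  move=> _ [r Rr ->]; split; first exact: (submodZ mod1).
  by exists 0, r; rewrite rpred0 mulr0 add0r.
have [|lH HlH] := fg_submodule (l := l1) noeR (modH 0%N); first by move=> x [].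
(* An element of [H 0] is [t] times an element of [T], and a power of [m] multiplies the latter into
   [R1]. *)
have [k kP] : exists k, forall g, g \in lH -> tors N k g.
  apply: tors_uniform => // g glH.
  have [_ [z [r [Tz Rr ->]]]] : H 0%N g by rewrite HlH; exact: mem_span.
  rewrite expr1 -mulrDr.
  have /TP[_ [k]] : z + r \in T by rewrite rpredD // sub_transform.
  move: (z + r) => x kx; exists k; elim: k x kx => [|k IHk] x /= kx.
    by exists x.
  by move=> a ma; rewrite mulrCA; apply: IHk; exact: kx.
have [||||n0 n0P] := dcc_tors modN kP (H := H) => //.
  move=> n x Hx; apply: addm_subr modN _; rewrite -HlH.
  exact: decreasing_le HS (leq0n n) _ Hx.
(* Multiplication by a power of the unit [t] embeds [F] in [R1], so [F] is finitely generated over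
   [R]; it represents [T] modulo [t T]. *)
pose F := [set x | x \in T /\ R1 (t ^+ n0.+1 * x)].
have modF : submodule R F.
  apply: submodule_setI (submodS ring_sub_transform (submodule_subring T)) _.
  exact: submodule_preimM.
have [|l Fl] := fg_submodule (l := [seq t ^- n0.+1 * g | g <- l1]) noeR modF.
  move=> x [Tx R1x]; rewrite -[x](mulKr (unitrX n0.+1 Ut)); exact: span_map.
exists l => [x|x Tx]; first by rewrite -Fl => -[].
have [e R1e] : exists e, R1 (t ^+ e * x).
  have /TP[_ [k' k'x]] := Tx; exists k';
    elim: k' x {Tx} k'x => [|k' IHk] x /= kx.
    by rewrite mul1r.
  by rewrite exprSr -mulrA; apply: IHk; exact: kx.
(* Induction on an exponent [e] that brings [x] into [R1]. Beyond [n0], stationarity gives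
   [t ^+ e.+1 * x = t ^+ e.+2 * z + t * r], and dividing by [t] shows that [x - t * z] needs only
   the exponent [e]. *)
rewrite -Fl; elim: e x Tx R1e => [|e IHe] x Tx R1e.
  exists 0; rewrite ?rpred0 // mulr0 subr0; split=> //.
  by rewrite mul1r in R1e; apply: (submodZ mod1) => //; exact: rpredX.
have [lee|lte] := leqP e n0.
  exists 0; rewrite ?rpred0 // mulr0 subr0; split=> //.
  rewrite -(subnK (_ : e.+1 <= n0.+1)%N) // exprD -mulrA.
  by apply: (submodZ mod1) => //; exact: rpredX.
have [_ [z [r [Tz Rr xz]]]] : H e.+1 (t ^+ e.+1 * x).
  apply: (n0P e.+1); first exact: leqW (ltnW lte).
  apply: (decreasing_le HS (ltnW lte)); split=> //.
  by exists x, 0; rewrite mulr0 addr0; split=> //; exact: submod0 mod1.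
have [||w Tw Fw] := IHe (x - t * z).
- by rewrite rpredB ?rpredM.
- rewrite (_ : t ^+ e * _ = r) //; apply: (mulrI Ut).
  have -> : t * (t ^+ e * (x - t * z)) = t ^+ e.+1 * x - t ^+ e.+2 * z.
    by rewrite !exprS; ring.
  by rewrite xz addrC addKr.
- exists (z + w); first exact: rpredD.
  by rewrite mulrDr opprD addrA.
Qed.

(** Since [T] is a finitely generated [R]-module plus [t T], and [t T] lies in [I], the ideal [I] is
    generated by [t] and its part inside that finitely generated module. *)
Lemma transform_ideal_fg I t :
  ideal_of T I -> m t -> t \is a GRing.unit -> I t ->
  exists l, I = span T l.
Proof.
move=> [modI IT] mt Ut It; have [l lT Tl] := transform_mod_finite mt Ut.
have modRI := submodS ring_sub_transform modI.
have [|l' Il'] := fg_submodule (l := l) noeR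
  (submodule_setI modRI (submodule_span R l)); first by move=> x [].
exists (t :: l'); apply/seteqP; split=> x => [Ix|].
  have [z Tz lxz] := Tl _ (IT _ Ix); exists z => //.
  apply: (@span_subset _ R T l') => //; first exact: ring_sub_transform.
  rewrite [z * t]mulrC -Il'; split=> //.
  by apply: (submodB modI) => //; exact: (submodZr modI).
apply: (span_min modI) => g; rewrite inE => /predU1P[->//|gl'].
suff [] : (I `&` span R l) g by [].
by rewrite Il'; exact: mem_span.
Qed.

End Transform.

End DescendingChains.

(** * Minimal regular primes of the integral closure *)

Section MinimalPrime.

Variables (K : comUnitRingType) (R : subringClosed K) (m : set K).
Hypotheses (noeR : noeth R) (pm : prime_of R m).
Hypothesis m_inv : forall c, c \in R -> ~ m c ->
  exists2 c', c' \in R & m (1 - c * c').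
Hypothesis R_frac : forall x : K,
  exists s, [/\ s \in R, s \is a GRing.unit & x * s \in R].
Variables (t0 y : K).
Hypotheses (mt0 : m t0) (Ut0 : t0 \is a GRing.unit).
Hypothesis y_int : y \notin integral_closure R.
Hypothesis my_int : forall a, m a -> a * y \in integral_closure R.

Section InTransform.

Variables (l1 : seq K) (T : subringClosed K).
Notation R1 := (span R l1).
Hypothesis ringR1 : subring_set R1.
Hypothesis R1_int : forall x, R1 x -> x \in integral_closure R.
Hypothesis my_R1 : forall a, m a -> R1 (a * y).
Hypothesis TP : forall x,
  x \in T <-> x \in integral_closure R /\ exists k, tors m R1 k x.

Let RT : {subset R <= T} := ring_sub_transform ringR1 R1_int TP.
Let T_int : {subset T <= integral_closure R} := transform_int TP.

Let fgT I t : ideal_of T I -> m t -> t \is a GRing.unit -> I t ->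
    exists l, I = span T l.
Proof. exact: (transform_ideal_fg noeR pm m_inv ringR1 R1_int TP). Qed.

Variable lm : seq K.
Hypothesis mlm : m = span R lm.

Notation mT := (span T lm).

Let m_mT a : m a -> mT a.
Proof. by rewrite mlm; exact: span_subset. Qed.

Let mT_sub x : mT x -> x \in T.
Proof.
apply: (span_min (submodule_subring T)) => g glm /=; apply: RT.
by apply: (prime_sub pm); rewrite mlm; exact: mem_span.
Qed.

Let mT_y x : mT x -> x * y \in T.
Proof.
move=> mTx; rewrite mulrC.
apply: (span_min (submodule_preimM y (submodule_subring T)) _ mTx) => g glm /=.
rewrite mulrC; apply: (sub_transform R1_int TP); apply: my_R1.
by rewrite mlm; exact: mem_span.
Qed.

Let yT : y \notin T.
Proof. by apply: contra y_int; exact: T_int. Qed.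

Let prime_over n : prime_of T n -> mT `<=` n -> forall x, x \in R -> n x <-> m
  x.
Proof.
move=> pn mn x Rx; split=> [nx|/m_mT/mn//]; apply: contrapT => mx.
have [x' Rx' /m_mT/mn n1] := m_inv Rx mx; apply: (prime_proper pn).
by apply: (submod_subB (prime_mod pn) _ n1); apply: (submodZr (prime_mod pn));
  rewrite // RT.
Qed.

Let I : set K := [set x | x \in T /\ forall n, prime_of T n -> mT `<=` n -> n
  x].

Let ideal_I : ideal_of T I.
Proof.
split=> [|x []//]; split=> [|x z [Tx Ix] [Tz Iz]|a x Ta [Tx Ix]].
- by rewrite /I /= rpred0; split=> // n pn _; exact: submod0 (prime_mod pn).
- rewrite /I /= rpredD //; split=> // n pn mn.
  by apply: (submodD (prime_mod pn)); [apply: Ix | apply: Iz].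
- rewrite /I /= rpredM //; split=> // n pn mn.
  by apply: (submodZ (prime_mod pn)) => //; apply: Ix.
Qed.

Let mT_I x : mT x -> I x.
Proof. by move=> mx; split; [exact: mT_sub | move=> n _; apply]. Qed.

Let ideal_mT : ideal_of T mT.
Proof. by split; [exact: submodule_span | exact: mT_sub]. Qed.

Let I_nil x : I x -> exists k, mT (x ^+ k).
Proof.
move=> [Tx Ix]; apply: contrapT => xk.
have [|||n [pn mn nx _]] := @prime_disjoint _ T mT [set z | exists k, z = x ^+
  k] ideal_mT.
- by exists 0%N.
- by move=> _ _ [k ->] [k' ->]; exists (k + k')%N; rewrite exprD.
- by move=> z [mz [k zk]]; apply: xk; exists k; rewrite -zk.
- by apply: (nx x); split; [exact: Ix | exists 1%N].
Qed.

(** For each [g] in turn, the least power of [g] that multiplies [c * y] into [T] exists because [g]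
    is nilpotent modulo [mT]; one power less leaves an element outside [T] that [g] sends into
    [T]. *)
Let multiplier (l : seq K) : (forall g, g \in l -> I g) ->
  exists2 c, c \in T & c * y \notin T /\ forall g, g \in l -> g * (c * y) \in T.
Proof.
elim: l => [|g l IHl] lI; first by exists 1; rewrite ?rpred1 // mul1r.
have [|c Tc [cyT lc]] := IHl; first by move=> h hl; apply: lI;
  rewrite inE hl orbT.
have Ig := lI g (mem_head _ _); have [Tg _] := Ig.
have ex_k : exists k, g ^+ k * (c * y) \in T.
  by have [k mgk] := I_nil Ig; exists k; rewrite mulrCA rpredM // mT_y.
case: (ex_minnP ex_k) => -[|k]; first by rewrite expr0 mul1r (negPf cyT).
move=> gkT kmin; exists (g ^+ k * c); first by rewrite rpredM ?rpredX.
rewrite -[g ^+ k * c * y]mulrA; split.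
  by apply/negP => /kmin; rewrite ltnn.
move=> h; rewrite inE => /predU1P[->|/lc hcy].
  by rewrite [g * _]mulrA -exprS.
by rewrite mulrCA rpredM ?rpredX.
Qed.

(* z is chosen in T y, but not in T, with I z in T; if I z were contained in  *)
(* I, then z would be integral over T and hence in T.                         *)
Let escape : exists i z, [/\ I i, forall x, I x -> x * z \in T & ~ I (i * z)].
Proof.
have It0 : I t0 by apply/mT_I/m_mT.
have [l Il] := fgT ideal_I mt0 Ut0 It0.
have [|c Tc [cyT lc]] := @multiplier l; first by move=> g gl; rewrite Il;
  exact: mem_span.
pose z := c * y.
have Iz x : I x -> x * z \in T.
  rewrite Il mulrC => lx.
  apply: (span_min (submodule_preimM z (submodule_subring T)) _ lx) => g gl /=.
  by rewrite mulrC; exact: lc.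
apply: contrapT => noI; move/negP: cyT; apply; apply/TP.
have Izz x : I x -> I (x * z).
  by move=> Ix; apply: contrapT => nIxz; apply: noI; exists x, z.
have modR1 := submodule_span R l1.
split.
  apply: (integral_closure_trans T_int).
  apply: (integral_stable (r := t0) (l := l)) => //; first by rewrite -Il.
  by move=> x; rewrite -Il mulrC; exact: Izz.
(* Besides integrality, membership of [z] in [T] needs torsion: the finitely many products of [z]
   with generators of [m] are in [T], so one exponent serves them all. *)
have [|k kP] := @tors_uniform _ _ _ pm R1 [seq z * g | g <- lm] modR1.
  move=> _ /mapP[g glm ->].
  have : g * z \in T by apply/Iz/mT_I/mem_span.
  by rewrite mulrC => /TP[].
exists k.+1 => a ma; have lma : span R lm a by rewrite -mlm.
rewrite mulrC.
apply: (span_min (submodule_tors m k modR1) kP); exact: span_map.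
Qed.

(** Take [n] above [m] avoiding [u = i * z]. Locally at [n], this prime is generated by [i], so a
    regular prime [n0] inside [n] either contains [i], and then equals [n], or contains a regular
    [t] divisible by every power of [i] near [n]. Finite generation of a saturation of [t T]
    excludes the latter, as in Krull's principal ideal argument. *)
Lemma minimal_prime_transform : exists n, [/\ prime_of T n,
  forall x, x \in R -> n x <-> m x
  & forall n0, prime_of T n0 -> n0 `<=` n ->
    (exists2 r, n0 r & r \is a GRing.unit) -> n0 = n].
Proof.
have [i [z [Ii Iz nIiz]]] := escape; set u := i * z in nIiz.
have Ti : i \in T by case: Ii.
have Tu : u \in T by exact: Iz.
have [n [pn mn nu]] : exists n, [/\ prime_of T n, mT `<=` n & ~ n u].
  apply: contrapT => non; apply: nIiz; split=> // n pn mn.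
  by apply: contrapT => nu; apply: non; exists n.
have In x : I x -> n x by case=> _; apply.
have Rn := prime_over pn mn.
exists n; split=> // n0 pn0 n0n [r n0r Ur]; symmetry.
have [s [Rs Us Rrs]] := R_frac r.
pose t := r * s.
have n0t : n0 t by apply: (submodZr (prime_mod pn0)); rewrite // RT.
have mt : m t by apply/Rn => //; exact: n0n.
have Ut : t \is a GRing.unit by rewrite unitrMl.
(* If [i] is in [n0], then for [x] in [I] the product [x * u = i * (x * z)] is in [n0], and [u] is
   not; so [n0] contains [I] and lies over [m]. *)
have [n0i|n0i] := pselect (n0 i).
  have In0 x : I x -> n0 x.
    move=> Ix; have Tx : x \in T by case: Ix.
    have : n0 (x * u).
      by rewrite /u mulrCA; apply: (submodZr (prime_mod pn0)) => //; exact: Iz.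
    by case/(primeM pn0) => // /n0n.
  apply: (incomparable RT T_int pn0 pn n0n) => x Rx /(Rn x Rx) mx.
  by apply/In0/mT_I/m_mT.
(* Near [n] the radical [I] is all of [n]: otherwise a prime between [I] and [n] would miss [a], but
   both primes lie over [m] and so coincide. *)
have local_I a : n a -> exists v, [/\ v \in T, ~ n v & I (v * a)].
  move=> na; have Ta := prime_sub pn na.
  apply: contrapT => nov.
  have [|||n1 [pn1 In1 n1S _]] := @prime_disjoint _ T I
      [set x | exists v k, [/\ v \in T, ~ n v & x = v * a ^+ k]] ideal_I.
  - exists 1, 0%N; rewrite mulr1 rpred1; split=> //; exact: prime_proper pn.
  - move=> _ _ [v [k [Tv nv ->]]] [w [k' [Tw nw ->]]].
    exists (v * w), (k + k')%N; rewrite rpredM // exprD mulrACA; split=> //.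
    exact: (primeMn pn).
  - move=> x [Ix [v [k [Tv nv xE]]]]; apply: nov; exists v; split=> //.
    split=> [|n' pn' mn']; first exact: rpredM.
    have : n' (v * a ^+ k) by rewrite -xE; case: Ix => _; apply.
    case/(primeM pn') => [//||n'v|n'a]; first exact: rpredX.
      exact: (submodZr (prime_mod pn')).
    apply: (submodZ (prime_mod pn')) => //; exact: (primeX pn' Ta n'a).
  have mn1 : mT `<=` n1 by move=> x /mT_I/In1.
  have n1n : n1 `<=` n.
    move=> x n1x; apply: contrapT => nx; apply: (n1S x); split=> //.
    by exists x, 0%N; rewrite mulr1 (prime_sub pn1 n1x).
  have n1E : n = n1.
    apply: (incomparable RT T_int pn1 pn n1n) => x Rx /(Rn x Rx).
    by move/m_mT/mn1.
  apply: (n1S a); rewrite -n1E; split=> //; exists 1, 1%N.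
  by rewrite mul1r rpred1; split=> //; exact: prime_proper pn.
have step a : n a -> exists w b, [/\ w \in T, ~ n w, b \in T & w * a = i * b].
  move=> na; have Ta := prime_sub pn na; have [v [Tv nv Iva]] := local_I a na.
  exists (u * v), (v * a * z); rewrite rpredM // Iz //; split=> //.
    exact: (primeMn pn).
  by rewrite /u; ring.
(* The saturation of [t T] by the powers of [i], locally at [n]. As [G] is finitely generated, a
   single [k] and [w] work for all its elements. *)
pose G := [set x | x \in T /\ exists k w, [/\ w \in T, ~ n w &
  exists2 e, e \in T & i ^+ k * w * x = e * t]].
have Tt : t \in T by exact: RT.
have idG : ideal_of T G.
  split=> [|x []//]; split=> [|x x' [Tx [k [w [Tw nw [e Te xe]]]]]
      [Tx' [k' [w' [Tw' nw' [e' Te' xe']]]]]|a x Ta [Tx [k [w [Tw nw [e Te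
        xe]]]]]].
  - split; first exact: rpred0.
    exists 0%N, 1; rewrite rpred1; split=> //; first exact: prime_proper pn.
    by exists 0; rewrite ?rpred0 // mulr0 mul0r.
  - split; first exact: rpredD.
    exists (k + k')%N, (w * w'); rewrite rpredM //; split=> //.
      exact: (primeMn pn).
    exists (i ^+ k' * w' * e + i ^+ k * w * e').
      by rewrite rpredD // !rpredM ?rpredX.
    have -> : (i ^+ k' * w' * e + i ^+ k * w * e') * t =
        i ^+ k' * w' * (e * t) + i ^+ k * w * (e' * t) by ring.
    by rewrite -xe -xe' exprD; ring.
  - split; first exact: rpredM.
    exists k, w; split=> //; exists (a * e); first exact: rpredM.
    by rewrite mulrCA xe mulrA.
have Gt : G t.
  split=> //; exists 0%N, 1; rewrite rpred1; split=> //;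
    first exact: prime_proper pn.
  by exists 1; rewrite ?rpred1 // !mul1r.
have [lG GlG] := fgT idG mt Ut Gt.
have [k [w [Tw nw Gkw]]] : exists k w, [/\ w \in T, ~ n w &
    forall x, G x -> exists2 e, e \in T & i ^+ k * w * x = e * t].
  suff spanP (l : seq K) : (forall g, g \in l -> G g) -> exists k w,
      [/\ w \in T, ~ n w & forall x, span T l x ->
        exists2 e, e \in T & i ^+ k * w * x = e * t].
    have [|k [w [Tw nw lP]]] := spanP lG; first by move=> g gl; rewrite GlG;
      exact: mem_span.
    by exists k, w; split=> // x; rewrite GlG; exact: lP.
  elim: l => [|g l IHl] lG'.
    exists 0%N, 1; rewrite rpred1; split=> //; first exact: prime_proper pn.
    by move=> x /= ->; exists 0; rewrite ?rpred0 // mulr0 mul0r.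
  have [|k [w [Tw nw lP]]] := IHl; first by move=> h hl; apply: lG';
    rewrite inE hl orbT.
  have [Tg [k' [w' [Tw' nw' [e Te ge]]]]] := lG' g (mem_head _ _).
  exists (k + k')%N, (w * w'); rewrite rpredM //; split=> //.
    exact: (primeMn pn).
  move=> x [c Tc /lP[e' Te' xe]].
  exists (c * i ^+ k * w * e + i ^+ k' * w' * e').
    by rewrite rpredD // !rpredM ?rpredX.
  have -> : (c * i ^+ k * w * e + i ^+ k' * w' * e') * t =
      c * i ^+ k * w * (e * t) + i ^+ k' * w' * (e' * t) by ring.
  by rewrite -ge -xe exprD; ring.
have divide j : exists b v, [/\ n0 b, v \in T, ~ n v & v * t = i ^+ j * b].
  elim: j => [|j [b [v [n0b Tv nv vt]]]].
    exists t, 1; rewrite rpred1 expr0; split=> //; exact: prime_proper pn.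
  have [v' [b' [Tv' nv' Tb' v'b]]] := step b (n0n _ n0b).
  exists b', (v' * v); rewrite rpredM //; split=> //.
  - have : n0 (i * b') by rewrite -v'b; exact: (submodZ (prime_mod pn0)).
    by case/(primeM pn0).
  - exact: (primeMn pn).
  - by rewrite -mulrA vt exprSr mulrCA v'b mulrA.
(* One power beyond the uniform [k]: cancelling [t] then puts [v * w] in [i T], hence in [n],
   although neither factor is in [n]. *)
have [b [v [n0b Tv nv vt]]] := divide k.+1.
have [|e Te kb] := Gkw b.
  split; first exact: (prime_sub pn0).
  exists k.+1, 1; rewrite rpred1; split=> //; first exact: prime_proper pn.
  by exists v; rewrite // mulr1 vt.
have vw : v * w = i * e.
  apply: (mulIr Ut); rewrite -[i * e * t]mulrA -kb.
  by rewrite mulrAC vt exprS; ring.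
case: (primeMn pn Tv Tw nv nw); rewrite vw.
by apply: (submodZr (prime_mod pn)) => //; exact: In.
Qed.

End InTransform.

(** The prime of the transform [T] is lifted by lying over to the integral closure of [R];
    incomparability over [T] carries minimality along. *)
Lemma minimal_prime_integral_closure :
  exists n, [/\ prime_of (integral_closure R) n,
    forall x, x \in R -> n x <-> m x
    & forall n0, prime_of (integral_closure R) n0 -> n0 `<=` n ->
      (exists2 r, n0 r & r \is a GRing.unit) -> n0 = n].
Proof.
have [|lm mlm] := noeR (prime_mod pm); first by move=> x; exact: (prime_sub pm).
have [|l1 [ringR1 lR1 R1_int]] := @finite_subring _ R [seq y * a | a <- lm].
  move=> _ /mapP[a alm ->]; rewrite mulrC; apply: my_int.
  by rewrite mlm; exact: mem_span.
have modR1 := submodule_span R l1.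
have my_R1 a : m a -> span R l1 (a * y).
  by rewrite mlm mulrC => /(span_map y); apply: span_min => // g /lR1.
pose S := [set x | x \in integral_closure R /\ exists k, tors m (span R l1) k
  x].
have torsM k k' x z : tors m (span R l1) k x -> tors m (span R l1) k' z ->
    tors m (span R l1) (k + k') (x * z).
  elim: k x => [|k IHk] x /=; last by move=> mx mz a ma; rewrite mulrA;
    apply: IHk => //; exact: mx.
  rewrite add0n => R1x; elim: k' z => [|k' IHk] z /=;
    first by case: ringR1 => _ _; apply.
  by move=> mz a ma; rewrite mulrCA; apply: IHk; exact: mz.
have ringS : subring_set S.
  split=> [|x z [Rx [k kx]] [Rz [k' kz]]|x z [Rx [k kx]] [Rz [k' kz]]].
  - by split; [exact: rpred1 | exists 0%N; case: ringR1].
  - split; first exact: rpredB.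
    exists (maxn k k'); apply: (submodB (submodule_tors _ _ modR1)).
      exact: (tors_le pm modR1 (leq_maxl _ _) kx).
    exact: (tors_le pm modR1 (leq_maxr _ _) kz).
  - by split; [exact: rpredM | exists (k + k')%N; exact: torsM].
have [T TP] := subring_exists ringS.
have RT : {subset R <= T} := ring_sub_transform ringR1 R1_int TP.
have T_int : {subset T <= integral_closure R} := transform_int TP.
have intT : {subset integral_closure R <= integral_closure T} :=
  integral_closureS RT.
have [n [pn nm nmin]] := minimal_prime_transform ringR1 R1_int my_R1 TP mlm.
have [N pN Nn] := lying_over_exists T_int intT pn.
exists N; split=> // [x Rx|N0 pN0 N0N [r N0r Ur]].
  by rewrite -nm //; apply: Nn; exact: RT.
have N0nE : [set` T] `&` N0 = n.
  apply: nmin.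
  - split=> [|x []//|[_ /(prime_proper pN0)]//|x z Tx Tz [_]].
      exact: submodule_setI (submodule_subring T) (submodS T_int (prime_mod
        pN0)).
    by move=> /(primeM pN0 (T_int _ Tx) (T_int _ Tz))[]; [left | right].
  - by move=> x [Tx /N0N /(Nn x Tx)].
  - have [s [Rs Us Rrs]] := R_frac r; exists (r * s); last by rewrite unitrMl.
    split; first exact: RT.
    by apply: (submodZr (prime_mod pN0)) => //; exact/T_int/RT.
symmetry; apply: (incomparable T_int intT pN0 pN N0N) => x Tx /(Nn x Tx).
by rewrite -N0nE => -[].
Qed.

End MinimalPrime.

Section Overrings.

Variables (K : comUnitRingType) (A : subringClosed K).
Hypothesis A_K : is_total_quotient_ring A.

Lemma overring_total_quotient (B : subringClosed K) :
  {subset A <= B} -> is_total_quotient_ring B.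
Proof.
move=> AB; split=> [s rs|x].
  have [t [At Ut Ast]] := fracP A_K (val s).
  suff: val s * t \is a GRing.unit by rewrite unitrMl.
  apply: (nonzerodiv_unit A_K Ast) => x Ax; rewrite mulrA => xst.
  have xs : x * val s = 0 by apply: (mulIr Ut); rewrite mul0r.
  have : SubringOf (AB _ Ax) = 0.
    by apply: rs; rewrite mulr0 mulrC; apply: val_inj.
  by move/(congr1 val).
have [s [As Us Axs]] := fracP A_K x.
exists (SubringOf (AB _ Axs)), (SubringOf (AB _ As)); split.
  move=> y z syz; apply/val_inj/(mulrI Us); exact: (congr1 val syz).
by rewrite /= mulrK.
Qed.

Lemma regular_idealP (P : prime_idealr (subring_of A)) :
  regular_ideal P <-> exists2 r, prime_set P r & r \is a GRing.unit.
Proof.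
split=> [[r Pr /(lreg_unit A_K) Ur]|[_ [r Pr <-] /(lreg_unit A_K) rr]].
  by exists (val r) => //; exact/prime_setE.
by exists r.
Qed.

End Overrings.

(** * From non-integral elements to minimal regular primes of A' *)

Section MinimalRegularPrimes.

Variables (K : comUnitRingType) (A : subringClosed K).
Hypotheses (A_K : is_total_quotient_ring A) (noeA : noeth A).

Notation A' := (integral_closure A).

Let AA' : {subset A <= A'} := @sub_integral_closure K A.

Section MinimalOver.

Variable P : prime_idealr (subring_of A).
Notation R := (regular_quotient P).
Variable y : K.
Hypotheses (Preg : regular_ideal P) (y_int : y \notin integral_closure R).
Hypothesis Py_int : forall a, prime_set P a -> a * y \in integral_closure R.

Let pP := prime_of_prime_set P.

(** By [integral_local] the integral closure of [R] is a localization of A'. The prime found there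
    is contracted to A', and a smaller regular prime of A' is extended back to contradict
    minimality. *)
Lemma minimal_regular_prime_over :
  exists2 Q : prime_idealr (subring_of A'), minimal_regular_prime Q &
    spec_map (incl AA') Q = P.
Proof.
have [r Pr Ur] := (regular_idealP A_K P).1 Preg.
have AR := sub_regular_quotient A_K P.
have RR' : {subset R <= integral_closure R} := @sub_integral_closure K R.
have A'R' : {subset A' <= integral_closure R} := integral_closureS AR.
have R_frac x : exists s, [/\ s \in R, s \is a GRing.unit & x * s \in R].
  by have [s [As Us Axs]] := fracP A_K x; exists s; split; rewrite ?AR.
have [|N [pN NR Nmin]] := minimal_prime_integral_closure
    (noeth_regular_quotient A_K noeA (P := P)) (prime_local_max A_K P)
    (fun c => local_max_inv A_K noeA Pr Ur) R_frac
    (sub_local_max Pr) Ur y_int.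
  move=> a [s [As Ps Us Pas]]; rewrite -[a](mulrK Us) mulrAC rpredM ?Py_int //.
  by apply: RR'; exact: unit_inv_regular_quotient.
have NA x : x \in A -> N x <-> prime_set P x.
  move=> Ax; rewrite NR ?AR //.
  by split; [exact: local_max_sub | exact: sub_local_max].
have [|Q QE] := @prime_set_exists _ A' ([set` A'] `&` N).
  split=> [|x []//|[_ /(prime_proper pN)]//|x z A'x A'z [_]].
    exact: submodule_setI (submodule_subring _) (submodS A'R' (prime_mod pN)).
  by move=> /(primeM pN (A'R' _ A'x) (A'R' _ A'z))[]; [left | right].
have A'_K := overring_total_quotient A_K AA'.
have QP : spec_map (incl AA') Q = P.
  apply: prime_set_inj; rewrite prime_set_spec_map QE.
  apply/seteqP; split=> x; first by case=> Ax [_ /(NA x Ax)].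
  move=> Px; have Ax := prime_sub pP Px.
  by split=> //; split; [exact: AA' | exact/NA].
exists Q => //; split.
  apply: (regular_idealP A'_K Q).2; exists r => //; rewrite QE.
  have Ar := prime_sub pP Pr; split; [exact: AA' | exact/NA].
move=> Q0 /(regular_idealP A'_K)[r0 Q0r Ur0] Q0Q.
have pQ0 := prime_of_prime_set Q0.
have Q0N x : prime_set Q0 x -> N x.
  case=> q Qq <-; suff [] : ([set` A'] `&` N) (val q) by [].
  by rewrite -QE; apply/prime_setE/Q0Q.
have Q0P x : x \in A -> prime_set Q0 x -> prime_set P x.
  by move=> Ax /Q0N /(NA x Ax).
pose N0 := [set x | x \in integral_closure R /\ exists s, [/\ s \in A,
  ~ prime_set P s, s \is a GRing.unit & prime_set Q0 (x * s)]].
have modQ0 := prime_mod pQ0.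
have pN0 : prime_of (integral_closure R) N0.
  split=> [|x []//|[_ [s [As Ps _]]]|x z R'x R'z].
  - split=> [|x z [R'x [s [As Ps Us xs]]] [R'z [t [At Pt Ut zt]]]
        |a x R'a [R'x [s [As Ps Us xs]]]].
    + split; first exact: rpred0.
      exists 1; rewrite rpred1 unitr1 mul0r; split=> //.
        exact: prime_proper pP.
      exact: submod0 modQ0.
    + split; first exact: rpredD.
      exists (s * t); rewrite rpredM ?unitrMl //; split=> //.
        exact: (primeMn pP).
      have -> : (x + z) * (s * t) = t * (x * s) + s * (z * t) by ring.
      by apply: (submodD modQ0); apply: (submodZ modQ0) => //; apply: AA'.
    + split; first exact: rpredM.
      have /(integral_local A_K)[t [At Pt Ut A'at]] := R'a.
      exists (s * t); rewrite rpredM ?unitrMl //; split=> //.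
        exact: (primeMn pP).
      have -> : a * x * (s * t) = (a * t) * (x * s) by ring.
      exact: (submodZ modQ0).
  - by rewrite mul1r => /(Q0P s As).
  - have /(integral_local A_K)[s [As Ps Us A'xs]] := R'x.
    have /(integral_local A_K)[t [At Pt Ut A'zt]] := R'z.
    move=> [_ [u [Au Pu Uu xzu]]].
    have : prime_set Q0 ((x * s) * ((z * t) * u)).
      have -> : (x * s) * ((z * t) * u) = (s * t) * (x * z * u) by ring.
      by apply: (submodZ modQ0) => //; rewrite AA' // rpredM.
    case/(primeM pQ0) => //; first by rewrite rpredM // AA'.
      by left; split=> //; exists s.
    case/(primeM pQ0) => // [|zt|/(Q0P u Au)//]; first exact: AA'.
    by right; split=> //; exists t.
have N0N : N0 `<=` N.
  move=> x [R'x [s [As Ps Us /Q0N]]]; case/(primeM pN) => //.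
    by apply: RR'; exact: AR.
  by move/(NA s As).
have N0E : N0 = N.
  apply: Nmin => //; exists r0 => //; split.
    by apply: A'R'; exact: (prime_sub pQ0).
  exists 1; rewrite rpred1 unitr1 mulr1; split=> //; exact: prime_proper pP.
apply: prime_set_inj; rewrite QE; apply/seteqP; split=> x.
  by move=> Q0x; split; [exact: (prime_sub pQ0) | exact: Q0N].
move=> [/= A'x]; rewrite -N0E => -[_ [s [As Ps Us]]].
by case/(primeM pQ0) => //; [exact: AA' | move/(Q0P s As)].
Qed.

End MinimalOver.

(* P is maximal among the proper ideals of the form (R' : c z) in A, with R'  *)
(* the integral closure of the regular quotient ring of A at n.               *)
Lemma nonintegral_minimal_regular (n : prime_idealr (subring_of A)) z :
  z \notin integral_closure (regular_quotient n) ->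
  exists Q : prime_idealr (subring_of A'), [/\ minimal_regular_prime Q,
    {subset spec_map (incl AA') Q <= n} &
    z \notin regular_quotient (spec_map (incl AA') Q)].
Proof.
move=> z_int; pose R' := integral_closure (regular_quotient n).
have AR := sub_regular_quotient A_K n.
have AR' : {subset A <= R'}.
  by move=> x Ax; apply: (@sub_integral_closure _ (regular_quotient n));
    exact: AR.
have modR' := submodS AR' (submodule_subring R').
pose J c := [set a | a \in A /\ a * (c * z) \in R'].
pose F I := exists c, [/\ c \in A, c * z \notin R' & I = J c].
have idJ c : ideal_of A (J c).
  split=> [|x []//]; apply: submodule_setI (submodule_subring A) _.
  split=> [|x t|a x Aa] /=.
  - by rewrite mul0r rpred0.
  - by rewrite mulrDl; exact: rpredD.
  - by rewrite -mulrA => xR; rewrite rpredM // AR'.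
have [||_ [c [Ac czR' ->]] Jmax] := @noeth_maximal _ A F (J 1) noeA.
- by move=> _ [c [_ _ ->]]; exact: idJ.
- by exists 1; rewrite rpred1 mul1r.
have pJ : prime_of A (J c).
  split; try by case: (idJ c).
    by case=> _; rewrite mul1r; apply/negP.
  move=> a b Aa Ab [Aab abR'].
  have [aR'|aR'] := boolP (a * (c * z) \in R'); [by left | right].
  suff <- : J (a * c) = J c by split; rewrite // -mulrA mulrCA mulrA.
  apply: Jmax; first by exists (a * c); rewrite rpredM // -mulrA.
  move=> d [Ad dR']; split=> //; rewrite -mulrA mulrCA.
  by rewrite rpredM // AR'.
have [P PE] := prime_set_exists pJ.
have [s [As Us Azs]] := fracP A_K z.
have Ps : prime_set P s.
  by rewrite PE; split=> //; rewrite mulrCA [s * z]mulrC AR' // rpredM.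
have Pn_unit a : prime_set P a -> a \is a GRing.unit -> prime_set n a.
  rewrite PE => -[Aa aR'] Ua; apply: contrapT => na; move/negP: czR'; apply.
  rewrite -[c * z](mulKr Ua) rpredM //.
  by apply: (@sub_integral_closure _ (regular_quotient n));
    exact: unit_inv_regular_quotient.
have modP := prime_mod (prime_of_prime_set P).
have modn := prime_mod (prime_of_prime_set n).
(* For units of [K] this is [Pn_unit]; a general [a] is the difference of a regular translate
   [a + s * b] in [P] and a multiple of the unit [s] of [P]. *)
have Pn a : prime_set P a -> prime_set n a.
  move=> Pa; have Aa := prime_sub (prime_of_prime_set P) Pa.
  have [b Ab Uasb] := regular_translate A_K noeA Aa As Us.
  apply: (submod_subD modn (y := s * b)).
    by apply: (submodZr modn) => //; exact: Pn_unit.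
  apply: Pn_unit => //; apply: (submodD modP) => //.
  exact: (submodZr modP).
have R'P : {subset R' <= integral_closure (regular_quotient P)}.
  apply: integral_closureS => x /(regular_quotientP A_K)[t [At nt Ut Axt]].
  by apply/(regular_quotientP A_K); exists t; split=> // /Pn.
have not_denominator t : t \in A -> ~ prime_set P t -> z * t \notin A'.
  move=> At Pt; apply/negP => A'zt; apply: Pt; rewrite PE; split=> //.
  rewrite mulrCA [t * z]mulrC rpredM //; first exact: AR'.
  exact: (integral_closureS AR).
have [|||Q Qmin QP] := @minimal_regular_prime_over P (c * z).
- by apply/(regular_idealP A_K); exists s.
- apply/negP => /(integral_local A_K)[t [At Pt _ A'czt]]; apply: Pt.
  rewrite PE; split=> //; rewrite mulrC.
  exact: (integral_closureS AR).
- by move=> a; rewrite PE => -[_ /R'P].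
exists Q; rewrite QP; split=> //.
  by move=> q /prime_setE /Pn /prime_setE.
apply/negP => /(regular_quotientP A_K)[t [At Pt _ Azt]].
by move/negP: (not_denominator t At Pt); apply; exact: AA'.
Qed.


End MinimalRegularPrimes.

(** * Overrings with going down *)

Lemma DVR_unit_power (K : comUnitRingType) (V : subringClosed K) z w :
  is_DVR V -> z \is a GRing.unit -> z \notin V ->
  exists k, w * z^-1 ^+ k \in V.
Proof.
move=> [_ [v [_ vM _ v1 _] vV]] Uz Vz.
have v1E : oo_add (v z) (v z^-1) = Some 0 by rewrite -vM divrr.
case vz : (v z) v1E => [i|]; case vz' : (v z^-1) => [j|] // [ij].
have lti : (i < 0)%R.
  have [le0i|] := boolP (0 <= i)%R; last by lia.
  by case/negP: Vz; apply/vV; rewrite vz.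
have vk k : v (z^-1 ^+ k) = Some (j *+ k).
  elim: k => [|k IHk]; first by rewrite expr0 v1.
  by rewrite exprS vM IHk vz' /oo_add mulrS.
case vw : (v w) => [e|]; last by exists 0%N; apply/vV; rewrite mulr1 vw.
exists `|e|%N; apply/vV; rewrite vM vw vk /oo_add /oo_le.
have j1 : (1 <= j)%R by lia.
by rewrite -mulr_natr; nia.
Qed.

Lemma integral_ext_incl (K : comUnitRingType) (A B : subringClosed K)
    (AB : {subset A <= B}) :
  integral_ext (incl AB) <-> {subset B <= integral_closure A}.
Proof.
have rootE p (x : subring_of B) :
    root (map_poly (incl AB) p) x = root (map_poly val p) (val x).
  have -> : map_poly val p = map_poly val (map_poly (incl AB) p).
    by rewrite -map_poly_comp.
  by rewrite /root (horner_map val) -(inj_eq val_inj).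
split=> [BA x Bx|BA x].
  by have [p mon_p] := BA (SubringOf Bx); rewrite rootE inE; exists p.
have := BA _ (subring_valP x); rewrite inE => -[p mon_p px0].
by exists p; rewrite ?rootE.
Qed.

Lemma bijectiveP (T U : Type) (f : T -> U) :
  injective f -> (forall u, exists t, f t = u) -> bijective f.
Proof. by move=> injf /choice[g fg]; exists g => // t; apply: injf. Qed.

Section GoingDown.

Variables (K : comUnitRingType) (A : subringClosed K).
Hypotheses (A_K : is_total_quotient_ring A) (noeA : noeth A).
Hypothesis A_DVR : forall P : prime_idealr (subring_of (integral_closure A)),
  minimal_regular_prime P -> is_DVR (regular_quotient
    (spec_map (incl (@sub_integral_closure K A)) P)).
Variables (B : subringClosed K) (AB : {subset A <= B}).
Hypothesis gdB : going_down (incl AB).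

Let B_K : is_total_quotient_ring B := overring_total_quotient A_K AB.

(** Otherwise [z] has a pole at a DVR A_(p) with [p] inside the contraction of [Q]. Going down puts
    a prime [Q1] over [p] inside [Q], and clearing denominators in the pole writes a product of
    elements outside [Q1] as an element of [Q1]. *)
Lemma going_down_integral (Q : prime_idealr (subring_of B)) z :
  z \in regular_quotient Q ->
  z \in integral_closure (regular_quotient (spec_map (incl AB) Q)).
Proof.
move=> /(regular_quotientP B_K)[d [Bd Qd Ud Bzd]];
  apply: contrapT => /negP z_int.
have [P [Pmin Pn zP]] := nonintegral_minimal_regular A_K noeA z_int.
set p := spec_map _ P in Pn zP.
have [Q1 Q1Q Q1p] := gdB Pn (erefl _).
have Q1E : prime_set p = [set` A] `&` prime_set Q1.
  by rewrite -Q1p prime_set_spec_map.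
have pQ1 := prime_of_prime_set Q1.
have Q1d : ~ prime_set Q1 d by move=> /= [q /Q1Q Qq qd]; apply: Qd; exists q.
have [r Pr Ur] : exists2 r, prime_set P r & r \is a GRing.unit.
  by have [/(regular_idealP (overring_total_quotient A_K (@sub_integral_closure
    K A)))] := Pmin.
have [s [As Us Ars]] := fracP A_K r.
have Q1rs : prime_set Q1 (r * s).
  suff [] : ([set` A] `&` prime_set Q1) (r * s) by [].
  rewrite -Q1E prime_set_spec_map; split=> //.
  apply: (submodZr (prime_mod (prime_of_prime_set P))) => //.
  exact: sub_integral_closure.
have [t [At Ut Azt]] := fracP A_K z.
(* [z] may fail to be invertible; adding an element of [A] makes it a unit of [K] without changing
   whether it lies in A_(p). *)
have [x Ax Uztx] := regular_translate A_K noeA Azt At Ut.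
have Uzx : z + x \is a GRing.unit.
  rewrite -(mulrK Ut (z + x)) unitrMl ?unitrV //.
  by rewrite mulrDl [x * t]mulrC.
have zxp : z + x \notin regular_quotient p.
  apply: contra zP => zx; rewrite -(addrK x z) rpredB //.
  exact: sub_regular_quotient.
(* The power of [(z + x)^-1] is chosen to outweigh the inverse of [r * s], so that the factor
   [r * s] of [Q1] appears in [a * d ^+ k]. *)
have [k /(regular_quotientP A_K)[a [Aa pa Ua]]] :=
  DVR_unit_power (r * s)^-1 (A_DVR Pmin) Uzx zxp.
set b := _ * a => Ab; apply: pa; rewrite Q1E; split=> //.
have adk : a * d ^+ k = (r * s) * b * ((z + x) * d) ^+ k.
  have rsV : r * s * (r * s)^-1 = 1 by rewrite divrr // unitrMl.
  have zxV : (z + x) ^+ k * (z + x)^-1 ^+ k = 1.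
    by rewrite -exprMn divrr // expr1n.
  rewrite /b exprMn.
  have -> : forall e f u v, r * s * (e * f * a) * (u * v) =
      (r * s * e) * (u * f) * (a * v) by move=> *; ring.
  by rewrite rsV zxV !mul1r.
have : prime_set Q1 (a * d ^+ k).
  rewrite adk -mulrA; apply: (submodZr (prime_mod pQ1)) => //.
  apply: rpredM; first exact: AB.
  by rewrite rpredX // mulrDl rpredD // rpredM // AB.
case/(primeM pQ1) => //; [exact: AB | exact: rpredX | by move/(primeX pQ1 Bd)].
Qed.

(* If d in N1 is a unit of K but not in N2, then 1 / d is integral over the   *)
(* regular quotient ring at N2 `&` A: scaling by a denominator s, some power  *)
(* of s lies in the ideal generated by d, hence in N1.                        *)
Lemma same_contraction_sub (R C : subringClosed K) (N1 N2 : set K) :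
  {subset A <= R} -> {subset R <= C} ->
  (forall x, x \in C -> exists s,
    [/\ s \in A, s \is a GRing.unit, s^-1 \in C & x * s \in B]) ->
  {subset B <= C} -> prime_of C N1 -> prime_of C N2 ->
  (forall x, x \in R -> N1 x <-> N2 x) -> N1 `<=` N2.
Proof.
move=> AR RC C_frac BC pN1 pN2 N12.
have AC x : x \in A -> x \in C by move/AR/RC.
have N12A x : x \in A -> N1 x <-> N2 x by move/AR/N12.
have modN1 := prime_mod pN1; have modN2 := prime_mod pN2.
have unit12 d : N1 d -> d \is a GRing.unit -> N2 d.
  move=> N1d Ud; have [s [As Us Cs Bds]] := C_frac d (prime_sub pN1 N1d).
  suff N2ds : N2 (d * s) by rewrite -[d](mulrK Us); apply: (submodZr modN2).
  have N1ds : N1 (d * s) by apply: (submodZr modN1); rewrite // AC.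
  have Uds : d * s \is a GRing.unit by rewrite unitrMl.
  move: (d * s) Bds N1ds Uds => {N1d Ud s As Us Cs} {}d Bd N1d Ud.
  apply: contrapT => N2d.
  have [|Q2 Q2E] := @prime_set_exists _ B ([set` B] `&` N2).
    split=> [|x []//|[_ /(prime_proper pN2)]//|x z Bx Bz [_]].
      exact: submodule_setI (submodule_subring _) (submodS BC modN2).
    by move=> /(primeM pN2 (BC _ Bx) (BC _ Bz))[]; [left | right].
  have /going_down_integral : d^-1 \in regular_quotient Q2.
    apply/(regular_quotientP B_K); exists d; rewrite mulVr ?rpred1 //.
    by split=> //; rewrite Q2E => -[].
  move=> /(integral_local A_K)[s [As Q2s Us]].
  move=> /integral_closureP[n [c [Ac dsn]]].
  have N2s : ~ N2 s.
    move=> N2s; apply: Q2s; rewrite prime_set_spec_map Q2E; split=> //.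
    by split=> //; exact: AB.
  apply: N2s; apply/N12A => //; apply: (primeX (n := n) pN1 (AC _ As)).
  have -> : s ^+ n = \sum_(i < n) c i * s ^+ i * d ^+ (n - i).
    have dn : d^-1 ^+ n * d ^+ n = 1 by rewrite -exprMn mulVr // expr1n.
    rewrite -[LHS]mulr1 -dn mulrA mulrC -exprMn.
    rewrite [s * _]mulrC dsn mulr_sumr; apply: eq_bigr => i _.
    have -> : d ^+ n = d ^+ (n - i) * d ^+ i by rewrite -exprD subnK // ltnW.
    have di : d ^+ i * d^-1 ^+ i = 1 by rewrite -exprMn divrr // expr1n.
    rewrite exprMn -[RHS]mulr1 -di; move: (d^-1 ^+ i) => u; ring.
  apply: (submod_sum modN1) => i _.
  rewrite -(subnSK (ltn_ord i)) exprS; apply: (submodZ modN1).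
    by rewrite rpredM ?rpredX // AC.
  by apply: (submodZr modN1) => //; rewrite rpredX // BC.
move=> x N1x; have [s [As Us Axs]] := fracP A_K x.
(* If [N1] contains no unit of [K], the denominator [s] is outside both primes and [x * s] in [A]
   decides. Otherwise an element of [N1] translates [x] into a unit, to which [unit12] applies. *)
have [[r N1r Ur]|noU] := pselect (exists2 r, N1 r & r \is a GRing.unit);
  last first.
  have N1xs : N1 (x * s) by apply: (submodZr modN1); rewrite // AC.
  have /(N12A _ Axs) N2xs := N1xs.
  case/(primeM pN2 (prime_sub pN1 N1x) (AC _ As)): N2xs => // /(N12A _ As) N1s.
  by case: noU; exists s.
have [t [At Ut Art]] := fracP A_K r.
have N1rt : N1 (r * t) by apply: (submodZr modN1); rewrite // AC.
have Urt : r * t \is a GRing.unit by rewrite unitrMl.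
have Asrt : s * (r * t) \in A by rewrite rpredM.
have Usrt : s * (r * t) \is a GRing.unit by rewrite unitrMl.
have [y Ay Uxy] := regular_translate A_K noeA Axs Asrt Usrt.
have -> : x = x + (r * t) * y - (r * t) * y by rewrite addrK.
apply: (submodB modN2); last first.
  by apply: (submodZr modN2); [exact: AC | apply/N12A].
apply: unit12; first by apply: (submodD modN1) => //;
  apply: (submodZr modN1) => //; exact: AC.
have <- : (x * s + s * (r * t) * y) / s = x + (r * t) * y.
  by apply: (mulIr Us); rewrite divrK //; ring.
by rewrite unitrMl ?unitrV.
Qed.

(** [C] is [B] with the regular elements of [A] outside [q] inverted. It is integral over A_(q),
    lying over makes the contraction of primes surjective and [same_contraction_sub] injective, so
    (b) gives equality. *)
Lemma sub_regular_quotient_going_down :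
  (forall (P : prime_idealr (subring_of A)) (C : subringClosed K)
          (RC : {subset regular_quotient P <= C}),
     integral_ext (incl RC) -> unibranched (incl RC) ->
     regular_quotient P =i C) ->
  forall Q : prime_idealr (subring_of B),
    {subset B <= regular_quotient (spec_map (incl AB) Q)}.
Proof.
move=> unibr Q; set q := spec_map _ Q.
pose S : set K := [set x | exists s,
  [/\ s \in A, ~ prime_set q s, s \is a GRing.unit & x * s \in B]].
have pq := prime_of_prime_set q.
have ringS : subring_set S.
  split=> [|x z [s [As qs Us Bxs]] [t [At qt Ut Bzt]]
      |x z [s [As qs Us Bxs]] [t [At qt Ut Bzt]]].
  - exists 1; rewrite rpred1 unitr1 mulr1 rpred1; split=> //.
    exact: prime_proper pq.
  - exists (s * t); rewrite rpredM ?unitrMl //; split=> //.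
      exact: (primeMn pq).
    have -> : (x - z) * (s * t) = (x * s) * t - s * (z * t) by ring.
    by rewrite rpredB // rpredM // AB.
  - exists (s * t); rewrite rpredM ?unitrMl //; split=> //.
      exact: (primeMn pq).
    by rewrite mulrACA rpredM.
have [C CP] := subring_exists ringS.
have RC : {subset regular_quotient q <= C}.
  move=> x /(regular_quotientP A_K)[s [As qs Us Axs]]; apply/CP.
  by exists s; rewrite AB.
have AR := sub_regular_quotient A_K q.
have BC : {subset B <= C}.
  move=> x Bx; apply/CP; exists 1; rewrite rpred1 unitr1 mulr1; split=> //.
  exact: prime_proper pq.
have CR : {subset C <= integral_closure (regular_quotient q)}.
  move=> x /CP[s [As qs Us Bxs]]; rewrite -[x](mulrK Us) rpredM //.
    apply: going_down_integral; exact: sub_regular_quotient.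
  apply: (@sub_integral_closure _ (regular_quotient q)).
  exact: unit_inv_regular_quotient.
have C_frac x : x \in C -> exists s,
    [/\ s \in A, s \is a GRing.unit, s^-1 \in C & x * s \in B].
  move=> /CP[s [As qs Us Bxs]]; exists s; split=> //.
  by apply: RC; exact: unit_inv_regular_quotient.
suff RE : regular_quotient q =i C by move=> x /BC; rewrite RE.
apply: (unibr q C RC); first exact/integral_ext_incl.
apply: bijectiveP => [N1 N2 N12|P].
  have N12R x : x \in regular_quotient q -> prime_set N1 x <-> prime_set N2 x.
    move=> Rx; have := congr1 (@prime_set K _) N12; rewrite !prime_set_spec_map.
    by move=> /seteqP[le ge]; split=> Nx; [have [] := le x | have [] := ge x].
  have pN1 := prime_of_prime_set N1; have pN2 := prime_of_prime_set N2.
  apply: prime_set_inj; apply/seteqP; split.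
    exact: (same_contraction_sub AR RC C_frac BC pN1 pN2 N12R).
  by apply: (same_contraction_sub AR RC C_frac BC pN2 pN1) => x /N12R; tauto.
have pP := prime_of_prime_set P.
have [N pN NP] := lying_over_exists RC CR pP.
have [N' N'E] := prime_set_exists pN.
exists N'; apply: prime_set_inj; rewrite prime_set_spec_map N'E.
apply/seteqP; split=> [x [Rx /(NP x Rx)]//|x Px].
by have Rx := prime_sub pP Px; split=> //; exact/NP.
Qed.

End GoingDown.

(** * Flat overrings *)

Section Submod.

Variables (R : comNzRingType) (V : lmodType R) (W : submodClosed V).

Record submod_type := SubmodElt { submod_val : V;
  submod_valP : submod_val \in W }.

HB.instance Definition _ := [isSub for submod_val].
HB.instance Definition _ := [Choice of submod_type by <:].
HB.instance Definition _ := [SubChoice_isSubLmodule of submod_type by <:].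

End Submod.

Section FlatOverrings.

Variables (K : comUnitRingType) (A B : subringClosed K) (AB : {subset A <= B}).

Notation R := (subring_of A).
Notation M := (restr_scalars (incl AB)).

Definition kval (b : M) : K := val (b : subring_of B).

Lemma kvalZ (a : R) (b : M) : kval (a *: b) = val a * kval b.
Proof. by []. Qed.

Section Criterion.

Hypothesis denominators : forall b Q, b \in B -> prime_of B Q ->
  exists2 i, i \in A & ~ Q i /\ i * b \in A.

(* For i in A with i b in A for all the b occurring in s, evaluation at i is  *)
(* multiplication by i from B (x) N to N, which undoes N -> B (x) N up to i.  *)
Definition mulA (i : K) (b : M) : R := insubd 0 (i * kval b).

Lemma mulAE i b : i * kval b \in A -> val (mulA i b) = i * kval b.
Proof. exact: insubdK. Qed.

Section Evaluation.

Variable N : lmodType R.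
Implicit Types s t : seq (M * N).

Definition eval_at i s : N := \sum_(p <- s) mulA i p.1 *: p.2.

Definition clears i s := all (fun p => i * kval p.1 \in A) s.

Lemma clears_cat i s t : clears i (s ++ t) = clears i s && clears i t.
Proof. exact: all_cat. Qed.

Lemma eval_at_cat i s t : eval_at i (s ++ t) = eval_at i s + eval_at i t.
Proof. exact: big_cat. Qed.

Lemma clearsM i j s : j \in A -> clears i s -> clears (j * i) s.
Proof.
move=> Aj /allP si; apply/allP => p /si; rewrite -mulrA; exact: rpredM.
Qed.

Lemma eval_atM i j s (Aj : j \in A) : clears i s ->
  eval_at (j * i) s = SubringOf Aj *: eval_at i s.
Proof.
move=> /allP si; rewrite scaler_sumr; apply: eq_big_seq => p /si Ap.
rewrite scalerA; congr (_ *: _); apply: val_inj.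
have Ajp : j * i * kval p.1 \in A by rewrite -mulrA rpredM.
by rewrite (mulAE Ajp) -mulrA -(mulAE Ap).
Qed.

Lemma clears_exists Q s : prime_of B Q ->
  exists i, [/\ i \in A, ~ Q i & clears i s].
Proof.
move=> pQ; elim: s => [|p s [i [Ai Qi si]]].
  by exists 1; rewrite rpred1; split=> //; exact: prime_proper pQ.
have [j Aj [Qj jp]] := denominators (subring_valP (p.1 : subring_of B)) pQ.
exists (j * i); split; first exact: rpredM.
  by apply: (primeMn pQ) => //; exact: AB.
by rewrite /= clearsM // andbT mulrAC rpredM.
Qed.

(** The multiplier [i] depends on the derivation, since intermediate sums may bring in new
    denominators; multipliers of subderivations are combined by products, which stay outside [Q]. *)
Lemma tensor_eq_eval s t Q : tensor_eq s t -> prime_of B Q ->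
  exists i, [/\ i \in A, ~ Q i, clears i s, clears i t
             & eval_at i s = eval_at i t].
Proof.
move=> st pQ.
have two i j : i \in A -> j \in A -> ~ Q i -> ~ Q j -> ~ Q (i * j).
  by move=> Ai Aj Qi Qj; apply: (primeMn pQ) => //; exact: AB.
elim: st => {s t} [s|s t _ [i [Ai Qi si ti e]]|s t u _ [i [Ai Qi si ti e]]
  _ [j [Aj Qj tj uj f]]
  |s s' t t' _ [i [Ai Qi si si' e]]
    _ [j [Aj Qj tj tj' f]]|s t|n|m m' n|m n n'|a m n].
- by have [i [Ai Qi si]] := clears_exists s pQ; exists i.
- by exists i.
- exists (i * j); split; [exact: rpredM | exact: two | | exact: clearsM |].
    by rewrite mulrC clearsM.
  rewrite [RHS](eval_atM Ai uj) -f -(eval_atM Ai tj) mulrC.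
  by rewrite !(eval_atM Aj) // e.
- have cij (u : seq (M * N)) : clears i u -> clears (i * j) u.
    by rewrite mulrC; exact: clearsM.
  exists (i * j); rewrite !clears_cat !eval_at_cat.
  rewrite (eval_atM Ai tj) (eval_atM Ai tj') f.
  rewrite [in eval_at (i * j) s]mulrC [in eval_at (i * j) s']mulrC.
  rewrite (eval_atM Aj si) (eval_atM Aj si') e.
  split; [exact: rpredM | exact: two | | |by []].
    by rewrite cij // clearsM.
  by rewrite cij // clearsM.
- have [i [Ai Qi sti]] := clears_exists (s ++ t) pQ; exists i; split=> //.
    by move: sti; rewrite !clears_cat andbC.
  by rewrite !eval_at_cat addrC.
- exists 1; rewrite rpred1 /clears /= mul1r rpred0; split=> //.
    exact: prime_proper pQ.
  rewrite /eval_at big_seq1 big_nil /= (_ : mulA 1 0 = 0) ?scale0r //.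
  by apply: val_inj; rewrite mulAE mul1r ?rpred0.
- have [i [Ai Qi]] := clears_exists [:: (m, n); (m', n)] pQ.
  rewrite /clears /= andbT => /andP[im im'].
  have imm : i * kval (m + m') \in A by rewrite mulrDr rpredD.
  exists i; split; rewrite /clears //= ?im ?im' ?imm //.
  rewrite /eval_at !big_cons big_nil !addr0 -scalerDl; congr (_ *: _).
  by apply: val_inj; rewrite rmorphD /= !mulAE // mulrDr.
- have [i [Ai Qi]] := clears_exists [:: (m, n)] pQ.
  rewrite /clears /= andbT => im.
  exists i; split; rewrite /clears //= ?im //.
  by rewrite /eval_at !big_cons big_nil !addr0 -scalerDr.
- have [i [Ai Qi]] := clears_exists [:: (m, n)] pQ.
  rewrite /clears /= andbT => im.
  have iam : i * kval (a *: m) \in A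
    by rewrite kvalZ mulrCA rpredM ?subring_valP.
  exists i; split; rewrite /clears //= ?im ?iam //.
  rewrite /eval_at !big_cons big_nil !addr0 scalerA; congr (_ *: _).
  apply: val_inj; transitivity (val (mulA i m) * val a); last by [].
  by rewrite (mulAE iam) (mulAE im) kvalZ mulrCA mulrC.
Qed.

Definition mul_tensor (c : subring_of B) s : seq (M * N) :=
  [seq (c * (p.1 : subring_of B) : M, p.2) | p <- s].

Lemma tensor_eq_catACA s1 s2 s3 s4 :
  tensor_eq ((s1 ++ s2) ++ (s3 ++ s4)) ((s1 ++ s3) ++ (s2 ++ s4)).
Proof.
rewrite -!catA; apply: tensor_cat; first exact: tensor_refl.
by rewrite !catA; apply: tensor_cat; [exact: tensorC | exact: tensor_refl].
Qed.

Lemma mul_tensorD c d s :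
  tensor_eq (mul_tensor (c + d) s) (mul_tensor c s ++ mul_tensor d s).
Proof.
elim: s => [|[m n] s IHs]; first exact: tensor_refl.
have -> : mul_tensor (c + d) ((m, n) :: s) =
    [:: (c * (m : subring_of B) + d * (m : subring_of B) :
      M, n)] ++ mul_tensor (c + d) s.
  by rewrite /= mulrDl.
apply: tensor_trans (tensor_cat (tensorDl _ _ _) IHs) _.
exact: (tensor_eq_catACA [:: _] [:: _]).
Qed.

Lemma mul_tensor0 s : tensor_eq (mul_tensor 0 s) [::].
Proof.
elim: s => [|[m n] s IHs]; first exact: tensor_refl.
by rewrite /= mul0r; exact: tensor_trans (tensor_cat (tensor0 _ _) IHs)
  (tensor_refl _).
Qed.

Lemma mul_tensor1 s : mul_tensor 1 s = s.
Proof. by elim: s => //= -[m n] s ->; rewrite mul1r. Qed.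

Lemma mul_tensor_eval (c i : subring_of B) s :
  val i \in A -> clears (val i) s ->
  tensor_eq (mul_tensor (c * i) s) [:: (c : M, eval_at (val i) s)].
Proof.
move=> Ai; elim: s => [_|[m n] s IHs /andP[/= im si]].
  rewrite /eval_at big_nil; apply: tensor_sym.
  have := @tensorZ R M N 0 c 0; rewrite !scale0r => e.
  exact: tensor_trans (tensor_sym e) (tensor0 _ _).
rewrite /eval_at big_cons -/(eval_at _ _) /=.
apply: tensor_trans (tensor_sym (tensorDr _ _ _)).
apply: (@tensor_cat _ _ _ [:: _] [:: _] _ [:: _]); last exact: IHs.
have -> : (c * i * (m : subring_of B) : M) = mulA (val i) m *: (c : M).
  apply: val_inj; rewrite -/(kval _) -[RHS]/(kval _) kvalZ mulAE //.
  by rewrite /kval /=; ring.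
exact: tensorZ.
Qed.

End Evaluation.

(** The multipliers in [B] that identify [s] and [t] form an ideal [W]. For each prime [Q],
    evaluation and injectivity of [g] produce one outside [Q], so [W] contains [1]. *)
Lemma flat_overring : flat M.
Proof.
move=> N N' g g_inj s t gst.
have evalg i (u : seq (M * N)) :
    clears i (tensor_map g u) = clears i u /\
    eval_at i (tensor_map g u) = g (eval_at i u).
  rewrite /clears all_map /eval_at big_map raddf_sum; split=> //.
  by apply: eq_bigr => p _; exact: esym (linearZZ g _ _).
(* Quantifying over [b] makes [W] visibly stable under multiplication by [B]. *)
pose W : set K := [set c | exists2 d : subring_of B, c = val d &
  forall b, tensor_eq (mul_tensor (b * d) s) (mul_tensor (b * d) t)].
have idW : ideal_of B W.
  split=> [|_ [d -> _]]; last exact: subring_valP.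
  split=> [|_ _ [d -> dst] [e -> est]|a _ Ba [d -> dst]].
  - exists 0 => // b; rewrite mulr0.
    exact: tensor_trans (mul_tensor0 s) (tensor_sym (mul_tensor0 t)).
  - exists (d + e) => // b; rewrite mulrDr.
    apply: tensor_trans (mul_tensorD _ _ _) _.
    apply: tensor_trans (tensor_cat (dst b) (est b)) _.
    exact/tensor_sym/mul_tensorD.
  - by exists (SubringOf Ba * d) => // b; rewrite mulrA.
have [[d d1 dst]|W1] := pselect (W 1).
  have -> : s = mul_tensor (1 * d) s by rewrite mul1r (_ :
    d = 1) ?mul_tensor1 //; apply: val_inj.
  have -> : t = mul_tensor (1 * d) t by rewrite mul1r (_ :
    d = 1) ?mul_tensor1 //; apply: val_inj.
  exact: dst.
have [Q pQ WQ] := maximal_ideal idW W1.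
have [i [Ai Qi]] := tensor_eq_eval gst pQ.
rewrite !(evalg i _).1 !(evalg i _).2 => si ti /g_inj sti.
case: Qi; apply: WQ; exists (SubringOf (AB Ai)) => // b.
have := @mul_tensor_eval _ b (SubringOf (AB Ai)) t Ai ti.
rewrite /= -sti => /tensor_sym; apply: tensor_trans.
exact: (@mul_tensor_eval _ b (SubringOf (AB Ai)) s Ai si).
Qed.

End Criterion.

End FlatOverrings.

(** * Flatness forces denominators outside every prime *)

Section FlatDenominators.

Variables (K : comUnitRingType) (A B : subringClosed K).
Hypothesis A_K : is_total_quotient_ring A.
Variable AB : {subset A <= B}.

Notation R := (subring_of A).
Notation M := (restr_scalars (incl AB)).
Notation V := (restr_scalars (val : R -> K)).

Section Fractions.

Variable b : subring_of B.

Definition add_fraction : {pred V} := [pred x : V | `[<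
  exists u v : R, (x : K) = val u + val b * val v >]].

Fact add_fraction_submod : submod_closed add_fraction.
Proof.
split=> [|a x y]; rewrite !inE.
  by exists 0, 0; rewrite mulr0 addr0.
move=> [u [v xE]] [u' [v' yE]]; exists (a * u + u'), (a * v + v').
rewrite !rmorphD !rmorphM -[LHS]/(val a * (x : K) + (y : K)) xE yE; ring.
Qed.

HB.instance Definition _ :=
  GRing.isSubmodClosed.Build R V add_fraction add_fraction_submod.

Notation N := (submod_type add_fraction).

Definition coef_pred (n : N) (v : R) :=
  exists u : R, (val n : K) = val u + val b * val v.

Lemma coef_exists (n : N) : exists v, coef_pred n v.
Proof. by have := submod_valP n; rewrite inE => -[u [v e]]; exists v, u. Qed.

Definition coef (n : N) : R := sval (cid (coef_exists n)).

Lemma coefP n : coef_pred n (coef n).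
Proof. exact: svalP (cid (coef_exists n)). Qed.

Variable Q : set K.
Hypotheses (pQ : prime_of B Q) (bQ :
  forall i, i \in A -> i * val b \in A -> Q i).

Let modQ := prime_mod pQ.

(** Two coefficients of the same element differ by some [i] in [A] with [i * b] in [A], and such [i]
    are in [Q]; so [coef] is well defined modulo [Q]. *)
Lemma coef_mod n v : coef_pred n v -> Q (val (coef n) - val v).
Proof.
move=> [u' nv]; have [u nw] := coefP n; move: (coef n) nw => w nw; apply: bQ.
  by rewrite rpredB ?subring_valP.
have u'E : val u' = val u + val b * val w - val b * val v.
  by rewrite -nw nv addrK.
have -> : (val w - val v) * val b = val u' - val u by rewrite u'E; ring.
by rewrite rpredB ?subring_valP.
Qed.

Definition functional (s : seq (M * N)) : K :=
  \sum_(p <- s) kval p.1 * val (coef p.2).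

Lemma functional_tensor_eq s t :
  tensor_eq s t -> Q (functional s - functional t).
Proof.
have BM (x : M) : kval x \in B by exact: subring_valP.
have one x n : functional [:: (x, n)] = kval x * val (coef n)
  by exact: big_seq1.
elim=> {s t} [s|s t _ Qst|s t u _ Qst _ Qtu|s s' t t' _ Qs _ Qt|s t|n|m m' n|m
  n n'|a m n].
- by rewrite subrr; exact: submod0 modQ.
- by rewrite -opprB; exact: (submodN modQ Qst).
- by rewrite -(subrK (functional t) (functional s)) -addrA;
    exact: (submodD modQ Qst Qtu).
- by rewrite /functional !big_cat opprD addrACA; exact: (submodD modQ Qs Qt).
- by rewrite /functional !big_cat [X in _ - X]addrC subrr; exact: submod0 modQ.
- rewrite one /functional big_nil subr0 /kval /= mul0r; exact: submod0 modQ.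
- rewrite one /functional !big_cons big_nil addr0 /= /kval rmorphD /= mulrDl
    subrr.
  exact: submod0 modQ.
- rewrite one /functional !big_cons big_nil addr0 /= -mulrDr -mulrBr.
  apply: (submodZ modQ) => //.
  have [[v [u nv]] [v' [u' nv']]] := (coef_exists n, coef_exists n').
  have e : coef_pred (n + n') (v + v').
    by exists (u + u'); rewrite -[LHS]/((val n : K) + (val n' :
      K)) nv nv' !rmorphD; ring.
  have Qv := coef_mod (ex_intro _ u nv : coef_pred n v).
  have Qv' := coef_mod (ex_intro _ u' nv' : coef_pred n' v').
  have -> : val (coef (n + n')) - (val (coef n) + val (coef n')) =
      (val (coef (n + n')) - val (v + v')) -
      ((val (coef n) - val v) + (val (coef n') - val v')).
    by rewrite rmorphD /=; ring.
  apply: (submodB modQ); first exact: coef_mod.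
  exact: (submodD modQ).
- rewrite !one kvalZ.
  have [v [u nv]] := coef_exists n.
  have e : coef_pred (a *: n) (a * v).
    exists (a * u); rewrite !rmorphM -[LHS]/(val a * (val n : K)) nv; ring.
  have Qv := coef_mod (ex_intro _ u nv : coef_pred n v).
  have -> : val a * kval m * val (coef n) - kval m * val (coef (a *: n)) =
     (val a * kval m) * (val (coef n) - val v) -
      kval m * (val (coef (a *: n)) - val (a * v)).
    by rewrite rmorphM; ring.
  have Ba : val a \in B by apply: AB; exact: subring_valP.
  apply: (submodB modQ); apply: (submodZ modQ) => //; first by rewrite rpredM.
  exact: coef_mod.
Qed.

(** With N = A + b A, the tensors of [b] with [1] and of [1] with [b] agree over [K], hence over [N]
    by flatness. But [functional], which sends the tensor of [x] with [u + b v] to [x v] modulo [Q],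
    takes the values [0] and [1] on them. *)
Lemma flat_not_prime : ~ flat M.
Proof.
move=> flatM.
have N1 : (1 : V) \in add_fraction by rewrite inE; exists 1, 0;
  rewrite mulr0 addr0.
have Nb : (val b : V) \in add_fraction.
  by rewrite inE; exists 0, 1; rewrite rmorph1 mulr1 add0r.
have [r [Ar Ur Abr]] := fracP A_K (val b).
pose s : seq (M * N) := [:: (b : M, SubmodElt N1)].
pose t : seq (M * N) := [:: (1 : M, SubmodElt Nb)].
(* Over [K] both equal the tensor of [r * b] with [r^-1]: the scalars [r] and [b * r] of [A] can be
   moved across. *)
have st : tensor_eq s t.
  apply: (flatM N V (val : N -> V)); first exact: val_inj.
  rewrite /tensor_map /=.
  have -> : (1 : V) = SubringOf Ar *: (r^-1 :
    V) by rewrite -[RHS]/(r * r^-1) divrr.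
  have -> : (val b : V) = SubringOf Abr *: (r^-1 : V).
    by rewrite -[RHS]/(val b * r * r^-1) mulrK.
  apply: tensor_trans (tensor_sym (tensorZ _ _ _)) _.
  have -> : SubringOf Ar *: (b : M) = SubringOf Abr *: (1 : M).
    by apply: val_inj; rewrite /= mulr1 mulrC.
  exact: tensorZ.
have := functional_tensor_eq st; rewrite /functional !big_seq1 /=.
have Q1 : Q (val (coef (SubmodElt N1)) - val (0 : R)).
  by apply: coef_mod; exists 1; rewrite mulr0 addr0.
have Qb : Q (val (coef (SubmodElt Nb)) - val (1 : R)).
  by apply: coef_mod; exists 0; rewrite mulr1 add0r.
move: Q1 Qb; rewrite /kval /=;
  move: (subring_val (coef _)) (subring_val (coef _)) => c' c.
rewrite subr0 mul1r => Qc Qc' Qcc'; apply: (prime_proper pQ).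
have -> : 1 = val b * c - (val b * c - c') - (c' - 1) by ring.
apply: (submodB modQ) => //; apply: (submodB modQ) => //.
by apply: (submodZ modQ) => //; exact: subring_valP.
Qed.

End Fractions.

End FlatDenominators.

(** * The equivalence *)

Lemma noeth_subring (K : comUnitRingType) (A : subringClosed K) :
  noetherian (subring_of A) -> noeth A.
Proof.
move=> noeA I modI IA.
pose J : {pred (subring_of A)^o} :=
  [pred x | `[< I (val (x : subring_of A)) >]].
have [|n [g gP]] := noeA J.
  split=> [|a x y]; rewrite !inE; first exact: submod0 modI.
  move=> Ix Iy; apply: (submodD modI) => //.
  exact: (submodZ modI (subring_valP a) Ix).
exists [seq val (g i) | i <- enum 'I_n]; apply/seteqP; split=> x.
  move=> Ix; have /(gP (SubringOf (IA _ Ix)))[c xc] :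
    SubringOf (IA _ Ix) \in J by rewrite inE.
  have -> : x = val (\sum_(i < n) c i * g i) by rewrite -xc.
  rewrite rmorph_sum; apply: (submod_sum (submodule_span _ _)) => i _.
  rewrite rmorphM; apply: (submodZ (submodule_span _ _));
    first exact: subring_valP.
  by apply/mem_span/map_f; rewrite mem_enum.
apply: (span_min modI) => _ /mapP[i _ ->].
suff : g i \in J by rewrite inE.
apply/gP; exists (fun j => (j == i)%:R).
rewrite (bigD1 i) //= eqxx mul1r big1 ?addr0 // => j /negPf->.
by rewrite mul0r.
Qed.

Section PerinormalUnibranched.

Variables (K : comUnitRingType) (A : subringClosed K).
Hypothesis A_K : is_total_quotient_ring A.
Variables (P : prime_idealr (subring_of A)) (B : subringClosed K).
Variable RB : {subset regular_quotient P <= B}.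
Hypotheses (intB : integral_ext (incl RB)) (unibrB : unibranched (incl RB)).

Notation R := (regular_quotient P).

Let AR : {subset A <= R} := sub_regular_quotient A_K P.
Let BR : {subset B <= integral_closure R} := (integral_ext_incl RB).1 intB.

Lemma unibranched_inj (N1 N2 : set K) : prime_of B N1 -> prime_of B N2 ->
  (forall x, x \in R -> N1 x <-> N2 x) -> N1 = N2.
Proof.
move=> /prime_set_exists[Q1 <-] /prime_set_exists[Q2 <-] Q12.
congr prime_set; apply: (bij_inj unibrB); apply: prime_set_inj.
by rewrite !prime_set_spec_map; apply/seteqP; split=> x [Rx /(Q12 x Rx)].
Qed.

(** Lift [P1] to a prime [N1] of [B], then go up from [N1] to a prime with the same contraction to
    [R] as [Q2]. Unibranchedness identifies it with [Q2], so [N1] lies inside [Q2]. *)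
Lemma going_down_unibranched (AB : {subset A <= B}) : going_down (incl AB).
Proof.
move=> P1 P2 Q2 P12 Q2P2.
have pP1 := prime_of_prime_set P1; have modP1 := prime_mod pP1.
have pQ2 := prime_of_prime_set Q2; have pP := prime_of_prime_set P.
have P1Q2 x : prime_set P1 x -> prime_set Q2 x.
  case=> q /P12; rewrite -Q2P2 => Qq <-.
  by rewrite -[val q]/(val (incl AB q)); apply/prime_setE.
(* The denominators of [R] are units of [B], so they avoid [Q2] and hence [P1]; this is why [P1]
   extends to a prime of [R]. *)
have unit_notin s : s \in A -> ~ prime_set P s -> s \is a GRing.unit ->
    ~ prime_set Q2 s.
  move=> As Ps Us Q2s; apply: (prime_proper pQ2).
  rewrite -(divrr Us); apply: (submodZr (prime_mod pQ2)) => //.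
  by apply: RB; exact: unit_inv_regular_quotient.
pose p1 := [set x | x \in R /\ exists s, [/\ s \in A, ~ prime_set P s,
  s \is a GRing.unit & prime_set P1 (x * s)]].
have pp1 : prime_of R p1.
  split=> [|x []//|[_ [s [As Ps Us]]]|x z Rx Rz].
  - split=> [|x z [Rx [s [As Ps Us xs]]] [Rz [t [At Pt Ut zt]]]
        |a x Ra [Rx [s [As Ps Us xs]]]].
    + split; first exact: rpred0.
      exists 1; rewrite rpred1 unitr1 mul0r; split=> //.
        exact: prime_proper pP.
      exact: submod0 modP1.
    + split; first exact: rpredD.
      exists (s * t); rewrite rpredM ?unitrMl //; split=> //.
        exact: (primeMn pP).
      have -> : (x + z) * (s * t) = t * (x * s) + s * (z * t) by ring.
      by apply: (submodD modP1); apply: (submodZ modP1).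
    + split; first exact: rpredM.
      have /(regular_quotientP A_K)[t [At Pt Ut Aat]] := Ra.
      exists (s * t); rewrite rpredM ?unitrMl //; split=> //.
        exact: (primeMn pP).
      have -> : a * x * (s * t) = (a * t) * (x * s) by ring.
      exact: (submodZ modP1).
  - by rewrite mul1r => /P1Q2; exact: unit_notin.
  - have /(regular_quotientP A_K)[s [As Ps Us Axs]] := Rx.
    have /(regular_quotientP A_K)[t [At Pt Ut Azt]] := Rz.
    move=> [_ [u [Au Pu Uu xzu]]].
    have : prime_set P1 ((x * s) * ((z * t) * u)).
      have -> : (x * s) * ((z * t) * u) = (s * t) * (x * z * u) by ring.
      by apply: (submodZ modP1) => //; rewrite rpredM.
    case/(primeM pP1) => //; first by rewrite rpredM.
      by left; split=> //; exists s.
    case/(primeM pP1) => // [zt|/P1Q2 /(unit_notin u Au Pu Uu)//].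
    by right; split=> //; exists t.
have p1Q2 x : p1 x -> prime_set Q2 x.
  move=> [Rx [s [As Ps Us /P1Q2]]].
  by case/(primeM pQ2) => //;
    [exact: RB | exact: (AB) | move/(unit_notin s As Ps Us)].
have [N1 pN1 N1p1] := lying_over_exists RB BR pp1.
have [p2 p2E] : exists p2 : prime_idealr (subring_of R),
    prime_set p2 = [set` R] `&` prime_set Q2.
  by exists (spec_map (incl RB) Q2); rewrite prime_set_spec_map.
have [||N2 [pN2 N12 N2p2]] :=
  @lying_over _ _ _ RB BR N1 _ (prime_of_prime_set p2).
- exact: ideal_prime.
- by move=> x Rx /(N1p1 x Rx) /p1Q2; rewrite p2E.
have N2E : N2 = prime_set Q2.
  apply: unibranched_inj => // x Rx; rewrite (N2p2 x Rx) p2E.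
  by split=> [[]|].
have [Q1 Q1E] := prime_set_exists pN1.
exists Q1.
  by move=> q /prime_setE; rewrite Q1E => /N12; rewrite N2E => /prime_setE.
apply: prime_set_inj; rewrite prime_set_spec_map Q1E.
apply/seteqP; split=> [x [/= Ax /(N1p1 x (AR Ax))[_ [s [As Ps Us]]]]|x P1x].
  by case/(primeM pP1) => // /P1Q2 /(unit_notin s As Ps Us).
have Ax := prime_sub pP1 P1x; split=> //; apply/N1p1; first exact: AR.
split; first exact: AR.
exists 1; rewrite rpred1 unitr1 mulr1; split=> //; exact: prime_proper pP.
Qed.

Lemma flat_integral_eq (AB : {subset A <= B}) :
  flat (restr_scalars (incl AB)) -> R =i B.
Proof.
move=> flatB b; apply/idP/idP => [/RB//|Bb]; apply: contrapT => Rb.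
pose J := [set x | x \in R /\ x * b \in R].
have idJ : ideal_of R J.
  split=> [|x []//]; split=> [|x y [Rx Rxb] [Ry Ryb]|a x Ra [Rx Rxb]].
  - by split; rewrite ?mul0r; exact: rpred0.
  - by split; rewrite ?mulrDl; exact: rpredD.
  - by split; rewrite -?mulrA; exact: rpredM.
have [|p pp Jp] := maximal_ideal idJ; first by move=> [_]; rewrite mul1r.
have [Q pQ Qp] := lying_over_exists RB BR pp.
apply: (flat_not_prime A_K (b := SubringOf Bb) pQ _ flatB) => i Ai Aib.
by apply/Qp; [exact: AR | apply: Jp; split; exact: AR].
Qed.

End PerinormalUnibranched.

Theorem theorem27 (K : comUnitRingType) (A : subringClosed K)
    (A_K : is_total_quotient_ring A)
    (A_noeth : noetherian (subring_of A))
    (A_DVR : forall P : prime_idealr (subring_of (integral_closure A)),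
       minimal_regular_prime P ->
       is_DVR (regular_quotient
                 (spec_map (incl (@sub_integral_closure K A)) P))) :
  perinormal A <->
  (forall (P : prime_idealr (subring_of A)) (B : subringClosed K)
          (AB : {subset regular_quotient P <= B}),
     integral_ext (incl AB) -> unibranched (incl AB) ->
     regular_quotient P =i B).
Proof.
split=> [periA P B RB intB unibrB|unibr B AB gdB].
  have AB : {subset A <= B} by move=> x Ax; apply/RB/sub_regular_quotient.
  apply: (flat_integral_eq A_K intB (AB := AB)); apply: periA.
  exact: going_down_unibranched unibrB AB.
apply: flat_overring => b Q Bb pQ; have noeA := noeth_subring A_noeth.
have [Q' Q'E] := prime_set_exists pQ.
have BQ' := sub_regular_quotient_going_down A_K noeA A_DVR gdB unibr Q'.
have /(regular_quotientP A_K)[s [As Qs Us Abs]] := BQ' _ Bb; exists s => //.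
split; last by rewrite mulrC.
by move=> Q's; apply: Qs; rewrite prime_set_spec_map Q'E; split.
Qed.
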